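(* Let $\xi=\{\xi_a:a\in\Lambda\}$ be a family of vector bundles over $M$ with linear transports ${}^{a,b}I_{x\to y}$ and a formal connection ${}^{a,b}_{\ \ x}\nabla_V$, whose components are smooth; let ${}^{a,b}\widetilde\nabla_V$, ${}^{a,b}I$ and the curvature operators ${}^{a,b,c}R$, ${}^{a,b,c}D$ be as defined in the context. Then for all $a,b,c,d\in\Lambda$ and all smooth vector fields $A,B,C$ on $M$, the following identity holds when applied to an arbitrary $T\in\mathrm{Sec}^2(\xi_a)$: $$\Bigl[{}^{c,d}\widetilde\nabla_A\circ\bigl({}^{a,b,c}R(B,C)+{}^{a,b,c}D(B,C)+{}^{b,c}I\circ{}^{a,b}\widetilde\nabla_{[B,C]_-}\bigr)-\bigl({}^{b,c,d}R(B,C)+{}^{b,c,d}D(B,C)+{}^{c,d}I\circ{}^{b,c}\widetilde\nabla_{[B,C]_-}\bigr)\circ{}^{a,b}\widetilde\nabla_A\Bigr]_{<A,B,C>}=0 .$$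
   Context: $\xi=\{\xi_a=(E_a,\pi_a,M):a\in\Lambda\}$, $\Lambda\ne\emptyset$, is a family of real vector bundles of equal finite dimension over a differentiable manifold $M$; $\mathrm{Sec}^k(\xi_a)$ is the set of $C^k$ sections and $\mathrm{Sec}(\xi_a)$ the set of all sections. $[B,C]_-:=B\circ C-C\circ B$ for vector fields. The notation $[\ldots]_{<A,B,C>}$ means the sum of the three expressions obtained from $[\ldots]$ by the cyclic permutations of $(A,B,C)$ (the bundle indices $a,b,c,d$ are not permuted). Transports: linear maps ${}^{a,b}I_{x\to y}:\pi_a^{-1}(x)\to\pi_b^{-1}(y)$, $x,y\in M$, with ${}^{b,c}I_{y\to z}\circ{}^{a,b}I_{x\to y}={}^{a,c}I_{x\to z}$ and ${}^{a,a}I_{x\to x}=\mathrm{id}$. Put $({}^{a,b}I_x(T))(y):={}^{a,b}I_{x\to y}T(x)$ and $({}^{a,b}I(T))(x):={}^{a,b}I_{x\to x}(T(x))$ for $T\in\mathrm{Sec}(\xi_a)$. Formal connection: maps ${}^{a,b}_{\ \ x}\nabla_V:\mathrm{Sec}^1(\xi_a)\to\mathrm{Sec}(\xi_b)$ ($x\in M$, $V$ a vector field) that are additive in the section, additive in $V$, and satisfy ${}^{a,b}_{\ \ x}\nabla_{fV}=f(x)\,{}^{a,b}_{\ \ x}\nabla_V$ and ${}^{a,b}_{\ \ x}\nabla_V\circ(f\cdot)={}^{a,b}I_x\circ(V(f)\cdot)+f(x)\,{}^{a,b}_{\ \ x}\nabla_V$ for $C^1$ functions $f:M\to\mathbb R$.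 Put $({}^{a,b}\widetilde\nabla_VT)(x):=({}^{a,b}_{\ \ x}\nabla_VT)(x)$ for $T\in\mathrm{Sec}^1(\xi_a)$. Components: in local frames $\{e^a_i\}$ of $\xi_a$ and local coordinates $\{x^\alpha\}$ of $M$, ${}^{a,b}I_{x\to y}e^a_i(x)={}^{a,b}H^{j}_{\ i}(y,x)e^b_j(y)$ and $({}^{a,b}_{\ \ x}\nabla_{\partial/\partial x^\alpha}e^a_i)(y)={}^{a,b}\Gamma^{j}_{\ i\alpha}(y,x)e^b_j(y)$ (summation convention). Curvatures: let $${}^{a,b,c}K^{j\,\gamma}_{\ k\beta\alpha}:={}^{b,c}H^j_{\ i}(x,x)\Bigl(\tfrac{d\,{}^{a,b}H^i_{\ k}(x,x)}{dx^\beta}\delta^\gamma_\alpha+{}^{a,b}\Gamma^i_{\ k\alpha}(x,x)\delta^\gamma_\beta\Bigr)+{}^{b,c}\Gamma^j_{\ i\beta}(x,x)\,{}^{a,b}H^i_{\ k}(x,x)\delta^\gamma_\alpha ,$$ where $d/dx^\beta$ differentiates the function $x\mapsto{}^{a,b}H^i_{\ k}(x,x)$. Set ${}^{a,b,c}D^{j\,\gamma}_{\ i\beta\alpha}:={}^{a,b,c}K^{j\,\gamma}_{\ i\beta\alpha}-{}^{a,b,c}K^{j\,\gamma}_{\ i\alpha\beta}$ and $${}^{a,b,c}R^j_{\ i\beta\alpha}:=\Bigl({}^{b,c}H^j_{\ k}(x,x)\tfrac{d}{dx^\beta}{}^{a,b}\Gamma^k_{\ i\alpha}(x,x)+{}^{b,c}\Gamma^j_{\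 k\beta}(x,x)\,{}^{a,b}\Gamma^k_{\ i\alpha}(x,x)\Bigr)-\Bigl(\alpha\leftrightarrow\beta\Bigr)-{}^{a,b,c}D^{j\,\gamma}_{\ k\beta\alpha}\,{}^{a,a}\Gamma^k_{\ i\gamma}(x,x).$$ The curvature operators are $$({}^{a,b,c}R(W,V)T)(x)={}^{a,b,c}R^j_{\ i\beta\alpha}T^i(x)W^\beta(x)V^\alpha(x)e^c_j(x),$$ $$({}^{a,b,c}D(W,V)T)(x)={}^{a,b,c}D^{j\,\gamma}_{\ i\beta\alpha}\bigl(({}^{a,a}\widetilde\nabla_{\partial/\partial x^\gamma}T)(x)\bigr)^iW^\beta(x)V^\alpha(x)e^c_j(x)$$ for $T=T^ie^a_i\in\mathrm{Sec}^1(\xi_a)$. *)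

(* Defs.v *)
From HB Require Import structures.
From mathcomp Require Export all_boot all_order all_algebra.
From mathcomp Require Export all_classical all_reals all_analysis.
Export numFieldNormedType.Exports.

Set Implicit Arguments.
Unset Strict Implicit.
Unset Printing Implicit Defensive.

Import Order.TTheory GRing.Theory Num.Theory.

Local Open Scope classical_set_scope.
Local Open Scope ring_scope.

(* f is C^k on the open set U: k times differentiable in the sense of Frechet,
   with continuous derivatives of order k.  Only the germs of f at the points
   of U matter. *)
Fixpoint Ck (R : realType) (V W : normedModType R) (k : nat) (U : set V)
    (f : V -> W) : Prop :=
  match k with
  | 0%N => forall u, U u -> {for u, continuous f}
  | k'.+1 => (forall u, U u -> differentiable f u) /\
             (forall v : V, Ck k' U (fun u => 'd f u v))
  end.

Definition smooth_on (R : realType) (V W : normedModType R) (U : set V)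
    (f : V -> W) : Prop := forall k, Ck k U f.

(* An n-dimensional manifold, given by a smooth atlas indexed by [cidx].
   [chartV i] is the inverse of [chart i] on the image of [cdom i].  For each
   point x, [chart_at x] is some chart of the atlas around x.  Second
   countability is not required. *)
Record manifold (R : realType) (n : nat) := Manifold {
  carrier :> topologicalType;
  manifold_hausdorff : hausdorff_space carrier;
  cidx : Type;
  cdom : cidx -> set carrier;
  chart : cidx -> carrier -> 'rV[R]_n;
  chartV : cidx -> 'rV[R]_n -> carrier;
  cdom_open : forall i, open (cdom i);
  cimg_open : forall i, open (chart i @` cdom i);
  chartK : forall i x, cdom i x -> chartV i (chart i x) = x;
  chart_continuous : forall i x, cdom i x -> {for x, continuous (chart i)};
  chartV_continuous : forall i u, (chart i @` cdom i) u ->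
    {for u, continuous (chartV i)};
  chart_smooth : forall i j,
    smooth_on (chart i @` (cdom i `&` cdom j)) (chart j \o chartV i);
  chart_at : carrier -> cidx;
  chart_atP : forall x, cdom (chart_at x) x
}.

(* f is C^k on the open subset U of M *)
Definition mCk (R : realType) (n : nat) (M : manifold R n)
    (W : normedModType R) (k : nat) (U : set M) (f : M -> W) : Prop :=
  forall i : cidx M, Ck k (chart i @` (cdom i `&` U)) (f \o chartV i).

(* partial derivative of f at x with respect to the alpha-th coordinate of
   the chart i *)
Definition pderiv (R : realType) (n : nat) (M : manifold R n) (i : cidx M)
    (alpha : 'I_n) (f : M -> R) (x : M) : R :=
  'd (f \o chartV i : 'rV[R]_n -> R^o) (chart i x) (delta_mx 0 alpha).

(* A vector field, not necessarily continuous.  The tangent space of M at x is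
   identified with R^n by means of the chart [chart_at x]: [V x] is the tuple
   of components of the tangent vector at x in that chart. *)
Definition vfield (R : realType) (n : nat) (M : manifold R n) : Type :=
  M -> 'rV[R]_n.

(* components of V in an arbitrary chart i, meaningful on [cdom i] *)
Definition vcomp (R : realType) (n : nat) (M : manifold R n) (i : cidx M)
    (V : vfield M) (x : M) : 'rV[R]_n :=
  'd (chart i \o chartV (chart_at x)) (chart (chart_at x) x) (V x).

Definition vsmooth (R : realType) (n : nat) (M : manifold R n)
    (V : vfield M) : Prop :=
  forall (k : nat) (i : cidx M), mCk k (cdom i) (vcomp i V).

(* V(f), the derivative of the function f along V *)
Definition vder (R : realType) (n : nat) (M : manifold R n) (V : vfield M)
    (f : M -> R) (x : M) : R :=
  'd (f \o chartV (chart_at x) : 'rV[R]_n -> R^o) (chart (chart_at x) x) (V x).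

(* The vector field [B, C] = B o C - C o B, determined by its action on C^2
   functions; the default value 0 is irrelevant for smooth B and C. *)
Definition vbracket (R : realType) (n : nat) (M : manifold R n)
    (B C : vfield M) : vfield M :=
  xget (fun=> 0 : 'rV[R]_n) [set X : M -> 'rV[R]_n |
    forall f : M -> R^o, mCk 2 setT f -> forall x,
      vder X f x = vder B (vder C f) x - vder C (vder B f) x].

(* the coordinate field d/dx^alpha of the chart i, extended by 0 outside its
   domain *)
Definition cfield (R : realType) (n : nat) (M : manifold R n) (i : cidx M)
    (alpha : 'I_n) : vfield M :=
  fun x => if `[< cdom i x >] then
    'd (chart (chart_at x) \o chartV i) (chart i x) (delta_mx 0 alpha)
  else 0.

(* A real vector bundle of rank r, with total space {x & fiber x}, whose
   topology and differentiable structure are the ones defined by the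
   trivializing atlas [triv p] over [tdom p], p : tidx. *)
Record vbundle (R : realType) (n : nat) (M : manifold R n) (r : nat) :=
  VBundle {
  fiber :> M -> lmodType R;
  tidx : Type;
  tdom : tidx -> set M;
  triv : tidx -> forall x, {linear fiber x -> 'rV[R]_r};
  trivV : tidx -> forall x, 'rV[R]_r -> fiber x;
  tdom_open : forall p, open (tdom p);
  trivK : forall p x, tdom p x -> cancel (triv p x) (trivV p x);
  trivVK : forall p x, tdom p x -> cancel (trivV p x) (triv p x);
  triv_smooth : forall p q (u : 'rV[R]_r) k,
    mCk k (tdom p `&` tdom q) (fun x => triv q x (trivV p x u));
  triv_at : M -> tidx;
  triv_atP : forall x, tdom (triv_at x) x
}.

Definition sec (R : realType) (n : nat) (M : manifold R n) (r : nat)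
    (E : vbundle M r) : Type := forall x : M, E x.

Definition Csec (R : realType) (n : nat) (M : manifold R n) (r : nat)
    (E : vbundle M r) (k : nat) (T : sec E) : Prop :=
  forall p : tidx E, mCk k (tdom p) (fun x => triv p x (T x)).

(* the local frame e_k over [tdom p] *)
Definition lframe (R : realType) (n : nat) (M : manifold R n) (r : nat)
    (E : vbundle M r) (p : tidx E) (k : 'I_r) : sec E :=
  fun x => trivV p x (delta_mx 0 k).

(* [tr a b x y] is the map from the fiber of xi_a over x to that of xi_b
   over y *)
Record transport (R : realType) (n : nat) (M : manifold R n) (r : nat)
    (Lam : Type) (xi : Lam -> vbundle M r) := Transport {
  tr : forall (a b : Lam) (x y : M), {linear xi a x -> xi b y};
  tr_comp : forall (a b c : Lam) (x y z : M) (u : xi a x),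
    tr b c y z (tr a b x y u) = tr a c x z u;
  tr_id : forall (a : Lam) (x : M) (u : xi a x), tr a a x x u = u
}.

(* [nab a b x V T] is the section of xi_b obtained from the section T of xi_a.
   The map is total, but it is constrained only on C^1 sections. *)
Record connection (R : realType) (n : nat) (M : manifold R n) (r : nat)
    (Lam : Type) (xi : Lam -> vbundle M r) (I : transport xi) := Connection {
  nab : forall a b : Lam, M -> vfield M -> sec (xi a) -> sec (xi b);
  nabD : forall (a b : Lam) (x : M) (V : vfield M) (S T : sec (xi a)),
    Csec 1 S -> Csec 1 T -> forall y,
    nab b x V (fun z => S z + T z) y = nab b x V S y + nab b x V T y;
  nabDv : forall (a b : Lam) (x : M) (V W : vfield M) (T : sec (xi a)),
    Csec 1 T -> forall y,
    nab b x (fun z => V z + W z) T y = nab b x V T y + nab b x W T y;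
  nabZv : forall (a b : Lam) (x : M) (V : vfield M) (f : M -> R^o)
    (T : sec (xi a)), mCk 1 setT f -> Csec 1 T -> forall y,
    nab b x (fun z => f z *: V z) T y = f x *: nab b x V T y;
  nab_leibniz : forall (a b : Lam) (x : M) (V : vfield M) (f : M -> R^o)
    (T : sec (xi a)), mCk 1 setT f -> Csec 1 T -> forall y,
    nab b x V (fun z => f z *: T z) y =
      tr I a b x y (vder V f x *: T x) + f x *: nab b x V T y
}.

Section Operators.
Variables (R : realType) (n : nat) (M : manifold R n) (r : nat).
Variables (Lam : Type) (xi : Lam -> vbundle M r).
Variables (I : transport xi) (N : connection I).

(* the operators a,b-I and a,b-tilde-nabla_V on sections *)
Definition trd (a b : Lam) (T : sec (xi a)) : sec (xi b) :=
  fun x => tr I a b x x (T x).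

Definition nabt (a b : Lam) (V : vfield M) (T : sec (xi a)) : sec (xi b) :=
  fun x => nab N b x V T x.

(* H^l_k (y, x) with respect to the frames p of xi_a and q of xi_b *)
Definition Hcomp (a b : Lam) (p : tidx (xi a)) (q : tidx (xi b))
    (l k : 'I_r) (y x : M) : R :=
  triv q y (tr I a b x y (lframe p k x)) 0 l.

(* Gamma^l_{k alpha} (y, x) with respect to the chart i and the frames p of
   xi_a and q of xi_b.  The connection acts on global sections, so e_k is
   replaced by some C^1 section with the same germ at x; by the Leibniz rule
   the result does not depend on the choice. *)
Definition Gcomp (a b : Lam) (i : cidx M) (p : tidx (xi a)) (q : tidx (xi b))
    (l k : 'I_r) (alpha : 'I_n) (y x : M) : R :=
  xget 0 [set g : R | exists T : sec (xi a),
    [/\ Csec 1 T,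
        (\forall z \near x, T z = lframe p k z)
      & g = triv q y (nab N b x (cfield i alpha) T y) 0 l]].

(* The components are smooth functions of (y, x), both points being read in
   arbitrary charts (the chart of x being the one used for d/dx^alpha). *)
Definition smooth_components : Prop :=
  forall (a b : Lam) (i j : cidx M) (p : tidx (xi a)) (q : tidx (xi b))
    (l k : 'I_r),
  let U := (chart j @` (cdom j `&` tdom q)) `*`
           (chart i @` (cdom i `&` tdom p)) in
  smooth_on U (fun u : 'rV[R]_n * 'rV[R]_n =>
    Hcomp p q l k (chartV j u.1) (chartV i u.2) : R^o) /\
  forall alpha : 'I_n, smooth_on U (fun u : 'rV[R]_n * 'rV[R]_n =>
    Gcomp i p q l k alpha (chartV j u.1) (chartV i u.2) : R^o).

(* In the next three definitions i is a chart and p, q, s are frames of xi_a,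
   xi_b, xi_c.  [Kcomp] is K^{j gamma}_{k beta alpha}, with the upper indices
   listed first; likewise below. *)
Definition Kcomp (a b c : Lam) (i : cidx M) (p : tidx (xi a))
    (q : tidx (xi b)) (s : tidx (xi c)) (j : 'I_r) (gamma : 'I_n)
    (k : 'I_r) (beta alpha : 'I_n) (x : M) : R :=
  \sum_(l < r)
    (Hcomp q s j l x x *
       (pderiv i beta (fun z => Hcomp p q l k z z) x * (gamma == alpha)%:R
        + Gcomp i p q l k alpha x x * (gamma == beta)%:R)
     + Gcomp i q s j l beta x x * Hcomp p q l k x x * (gamma == alpha)%:R).

Definition Dcomp (a b c : Lam) (i : cidx M) (p : tidx (xi a))
    (q : tidx (xi b)) (s : tidx (xi c)) (j : 'I_r) (gamma : 'I_n)
    (k : 'I_r) (beta alpha : 'I_n) (x : M) : R :=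
  Kcomp i p q s j gamma k beta alpha x - Kcomp i p q s j gamma k alpha beta x.

Definition Rcomp (a b c : Lam) (i : cidx M) (p : tidx (xi a))
    (q : tidx (xi b)) (s : tidx (xi c)) (j k : 'I_r) (beta alpha : 'I_n)
    (x : M) : R :=
  let HG (b' a' : 'I_n) := \sum_(l < r)
    (Hcomp q s j l x x * pderiv i b' (fun z => Gcomp i p q l k a' z z) x
     + Gcomp i q s j l b' x x * Gcomp i p q l k a' x x) in
  HG beta alpha - HG alpha beta
  - \sum_(l < r) \sum_(gamma < n)
      Dcomp i p q s j gamma l beta alpha x * Gcomp i p p l k gamma x x.

(* The curvature operators; their values at x are computed in the chart and
   the frames attached to x by [chart_at] and [triv_at]. *)
Definition curvR (a b c : Lam) (W V : vfield M) (T : sec (xi a)) :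
    sec (xi c) := fun x =>
  let i := chart_at x in
  let p := triv_at (xi a) x in
  let q := triv_at (xi b) x in
  let s := triv_at (xi c) x in
  \sum_(j < r) (\sum_(k < r) \sum_(beta < n) \sum_(alpha < n)
     Rcomp i p q s j k beta alpha x * triv p x (T x) 0 k
     * vcomp i W x 0 beta * vcomp i V x 0 alpha) *: lframe s j x.

Definition curvD (a b c : Lam) (W V : vfield M) (T : sec (xi a)) :
    sec (xi c) := fun x =>
  let i := chart_at x in
  let p := triv_at (xi a) x in
  let q := triv_at (xi b) x in
  let s := triv_at (xi c) x in
  \sum_(j < r) (\sum_(k < r) \sum_(gamma < n) \sum_(beta < n) \sum_(alpha < n)
     Dcomp i p q s j gamma k beta alpha x
     * triv p x (nabt a (cfield i gamma) T x) 0 k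
     * vcomp i W x 0 beta * vcomp i V x 0 alpha) *: lframe s j x.

(* R(W, V) + D(W, V) + I o tilde-nabla_[W, V] *)
Definition curv_sum (a b c : Lam) (W V : vfield M) (T : sec (xi a)) :
    sec (xi c) := fun x =>
  curvR b c W V T x + curvD b c W V T x
  + trd c (nabt b (vbracket W V) T) x.

(* the expression inside the cyclic sum, applied to T *)
Definition bianchi_term (a b c d : Lam) (A B C : vfield M) (T : sec (xi a)) :
    sec (xi d) := fun x =>
  nabt d A (curv_sum b c B C T) x - curv_sum c d B C (nabt b A T) x.

End Operators.

(* Main.v *)
(** Locally, for C^1 sections, [nab_V T] is a first order differential operator with smooth coefficients built from H(x,x) and Gamma(x,x). For C^2 sections the second order parts of [nab_B nab_C T] and [nab_C nab_B T] agree up to symmetry of second derivatives, and expanding in components gives R(B,C) + D(B,C) + I o nab_[B,C] = nab_B o nab_C - nab_C o nab_B. On C^3 sections the cyclic sum is therefore the trivial cancellation of twelve triple compositions.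

If T is only of class C^2, then [nab_A T] is only of class C^1 and [nab_B nab_C] cannot be applied to it. But R + D + I o nab_[B,C] is of first order, so each term of the cyclic sum depends only on the 2-jet of T at x, and T may be replaced by a C^3 section with the same 2-jet: its second Taylor polynomial, cut off by a bump function. *)

(* The curvature operators are computed at each point in the chart and frames attached to that
   point, and these may jump from one point to the next, so R + D cannot be differentiated directly
   from its definition. No transformation law for R or D is proved. Instead the pointwise equality
   of R + D + I o nab_[B,C] with the commutator is established in the attached charts; the
   commutator does not mention charts, hence it can be expanded around x in any fixed chart and
   frames, and this expansion is what gets differentiated.

   The second obstacle is that the connection is axiomatised on global sections and functions,
   whereas frames, components and coordinates are local. Every local object is therefore cut off by
   a function equal to 1 near the point, and locality is derived from the Leibniz rule. Cutoffs of a
   finite class are enough: C^1 for the axioms of the connection, C^2 for the bracket, C^3 for the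
   replacement of T. They are built from truncated powers. *)
From HB Require Import structures.
Require Import Defs.
From mathcomp Require Import ring lra.

Set Implicit Arguments.
Unset Strict Implicit.
Unset Printing Implicit Defensive.

Import Order.TTheory GRing.Theory Num.Theory.

Local Open Scope classical_set_scope.
Local Open Scope ring_scope.

(** * Germs of C^k maps between normed spaces *)

Section Germs.
Variables (R : realType) (V W : normedModType R).
Implicit Types (f g : V -> W) (u : V) (U : set V) (k : nat).

(** The first order expansion of [f] at [u] is also one of [g], and the continuous linear map in
    such an expansion is unique. *)
Lemma near_eq_diff f g u : (\forall z \near u, f z = g z) ->
  differentiable f u -> differentiable g u /\ 'd g u = 'd f u :> (V -> W).
Proof.
move=> fg df.
have fgu : f u = g u := nbhs_singleton fg.
have gE : g \o shift u = cst (g u) + 'd f u +o_ 0 id.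
  apply/eqaddoP => e e0.
  have := diff_locally df => /eqaddoP /(_ e e0) H.
  have N : \forall z \near (0 : V), f (z + u) = g (z + u).
    by move: fg; rewrite (near_shift 0 u) subr0.
  near=> z.
  have -> : (g \o shift u - (cst (g u) + 'd f u)) z
      = (f \o shift u - (cst (f u) + 'd f u)) z.
    rewrite !fctE /= -fgu; congr (_ - _); rewrite (near N z)//.
  by near: z.
have E := diff_unique (diff_continuous df) gE.
split; last exact: E.
apply/diff_locallyP; rewrite E; split; [exact: diff_continuous|exact: gE].
Unshelve. all: by end_near. Qed.

Lemma Ck_eq k U f g : open U -> (forall z, U z -> f z = g z) ->
  Ck k U f -> Ck k U g.
Proof.
move=> oU; elim: k f g => [|k IH] f g fg /=.
  move=> Cf u Uu; have N : \forall z \near u, f z = g z.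
    by apply: filterS fg _; exact: open_nbhs_nbhs.
  change (g @ u --> g u); rewrite -(fg u Uu); apply: cvg_trans (Cf u Uu).
  exact: near_eq_cvg.
move=> [df Cdf]; have N u : U u -> \forall z \near u, f z = g z.
  by move=> Uu; apply: filterS fg _; exact: open_nbhs_nbhs.
split=> [u Uu|v]; first by have [] := near_eq_diff (N u Uu) (df u Uu).
apply: IH (Cdf v) => z Uz.
have [_ E] := near_eq_diff (N z Uz) (df z Uz).
exact: esym (congr1 (fun h => h v) E).
Qed.

Lemma Ck_sub k U U' f : U' `<=` U -> Ck k U f -> Ck k U' f.
Proof.
move=> sU; elim: k f => [|k IH] f /=; first by move=> Cf u /sU /Cf.
by move=> [df Cdf]; split=> [u /sU /df //|v]; exact: IH.
Qed.

(** At every order [Ck] constrains the germ of [f] at each point of [U] separately, so it can be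
    tested on singletons. This allows regularity to be localised at a point. *)
Lemma Ck_point k U f : (forall u, U u -> Ck k [set u] f) -> Ck k U f.
Proof.
elim: k f => [|k IH] f /= Cf; first by move=> u Uu; exact: Cf Uu u erefl.
split=> [u Uu|v]; first by have [/(_ u erefl)] := Cf u Uu.
by apply: IH => u Uu; have [_] := Cf u Uu.
Qed.

Lemma CkS k U f : Ck k.+1 U f -> Ck k U f.
Proof.
elim: k f => [|k IH] f.
  by move=> [df _] u /df/differentiable_continuous.
by move=> [df Cdf]; split=> // v; exact: IH (Cdf v).
Qed.

(** The quantifier over nearby points matters: [Ck k [set u] f] alone does not give
    differentiability at the neighbours of [u], where ['d f] would then have no meaning. *)
Definition Ck_at k (u : V) f := \forall z \near u, Ck k [set z] f.

Lemma Ck_at_exP k u f : Ck_at k u f <-> exists U, [/\ open U, U u & Ck k U f].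
Proof.
split=> [H|[U [oU Uu CU]]].
  exists ([set z | Ck k [set z] f]°); split; first exact: open_interior.
    exact: H.
  apply: (@Ck_sub k [set z | Ck k [set z] f]); first exact: interior_subset.
  exact: Ck_point.
apply: filterS (open_nbhs_nbhs (conj oU Uu)) => z Uz.
by apply: Ck_sub CU => _ ->.
Qed.

Lemma Ck_atP k U f : open U -> Ck k U f <-> forall u, U u -> Ck_at k u f.
Proof.
move=> oU; split=> [CU u Uu|H].
  by apply/Ck_at_exP; exists U.
by apply: Ck_point => u Uu; have := nbhs_singleton (H u Uu).
Qed.

Lemma Ck_at_near k u f : Ck_at k u f -> \forall z \near u, Ck_at k z f.
Proof. exact: near_join. Qed.

Lemma Ck_at_eq k u f g : (\forall z \near u, f z = g z) ->
  Ck_at k u f -> Ck_at k u g.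
Proof.
move=> /nbhs_interior fg /Ck_at_exP[U [oU Uu CU]].
apply/Ck_at_exP; exists (U `&` [set z | f z = g z]°); split.
- exact/openI/open_interior.
- by split=> //; exact: nbhs_singleton fg.
- apply: (@Ck_eq k _ f); [exact/openI/open_interior| |].
    by move=> z [_ /interior_subset].
  by apply: Ck_sub CU => z [].
Qed.

Lemma Ck_at_le k k' u f : (k <= k')%N -> Ck_at k' u f -> Ck_at k u f.
Proof.
move=> /subnK <-; elim: (k' - k)%N => // m IH H; apply: IH.
by apply: filterS H => z; exact: CkS.
Qed.

Lemma Ck_at_diff k u f : Ck_at k.+1 u f -> differentiable f u.
Proof. by move=> /nbhs_singleton[/(_ u erefl)]. Qed.

Lemma Ck_at_d k u f v : Ck_at k.+1 u f -> Ck_at k u (fun z => 'd f z v).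
Proof. by apply: filterS => z [_ /(_ v)]. Qed.

Lemma Ck_cst k U (a : W) : Ck k U (fun=> a).
Proof.
elim: k a => [|k IH] a /=; first by move=> u _; exact: cst_continuous.
split=> [u _|v]; first exact: differentiable_cst.
apply: (eq_ind _ (Ck k U) (IH 0)); apply/funext => z.
by rewrite diff_cst.
Qed.

Lemma diffD_at f g z v : differentiable f z -> differentiable g z ->
  'd (fun z => f z + g z) z v = 'd f z v + 'd g z v.
Proof. by move=> df dg; exact: (congr1 (fun h => h v) (diffD df dg)). Qed.

Lemma Ck_add k U f g : open U -> Ck k U f -> Ck k U g ->
  Ck k U (fun z => f z + g z).
Proof.
move=> oU; elim: k f g => [|k IH] f g /=.
  by move=> Cf Cg u Uu; apply: cvgD; [exact: Cf|exact: Cg].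
move=> [df Cf] [dg Cg]; split=> [u Uu|v].
  by apply: differentiableD; [exact: df|exact: dg].
apply: Ck_eq (IH _ _ (Cf v) (Cg v)) => // z Uz.
exact: esym (diffD_at v (df z Uz) (dg z Uz)).
Qed.

End Germs.

(** * Algebra of real-valued C^k functions *)

Section RealValued.
Variables (R : realType) (V : normedModType R).
Implicit Types (f g : V -> R^o) (u : V) (U : set V) (k : nat).

Lemma diffM_at f g z v : differentiable f z -> differentiable g z ->
  'd (fun z => f z * g z : R^o) z v = f z * 'd g z v + g z * 'd f z v.
Proof. by move=> df dg; exact: (congr1 (fun h => h v) (diffM df dg)). Qed.

Lemma Ck_mul k U f g : open U -> Ck k U f -> Ck k U g ->
  Ck k U (fun z => f z * g z : R^o).
Proof.
move=> oU; elim: k f g => [|k IH] f g.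
  by move=> Cf Cg u Uu; apply: cvgM; [exact: Cf|exact: Cg].
move=> Cf' Cg'; have [df Cf] := Cf'; have [dg Cg] := Cg'.
split=> [u Uu|v].
  by apply: differentiableM; [exact: df|exact: dg].
have H1 := IH _ _ (CkS Cf') (Cg v); have H2 := IH _ _ (CkS Cg') (Cf v).
apply: Ck_eq (Ck_add oU H1 H2) => // z Uz.
exact: esym (diffM_at v (df z Uz) (dg z Uz)).
Qed.

Lemma Ck_at_cst (W : normedModType R) k u (a : W) : Ck_at k u (fun=> a).
Proof. by apply: filterE => z; exact: Ck_cst. Qed.

Lemma Ck_at_add (W : normedModType R) k u (f g : V -> W) :
  Ck_at k u f -> Ck_at k u g -> Ck_at k u (fun z => f z + g z).
Proof.
move=> /Ck_at_exP[U [oU Uu CU]] /Ck_at_exP[U' [oU' Uu' CU']].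
apply/Ck_at_exP; exists (U `&` U'); split=> //; first exact: openI.
apply: Ck_add; first exact: openI.
  by apply: Ck_sub CU => z [].
by apply: Ck_sub CU' => z [].
Qed.

Lemma Ck_at_mul k u f g :
  Ck_at k u f -> Ck_at k u g -> Ck_at k u (fun z => f z * g z : R^o).
Proof.
move=> /Ck_at_exP[U [oU Uu CU]] /Ck_at_exP[U' [oU' Uu' CU']].
apply/Ck_at_exP; exists (U `&` U'); split=> //; first exact: openI.
apply: Ck_mul; first exact: openI.
  by apply: Ck_sub CU => z [].
by apply: Ck_sub CU' => z [].
Qed.

Lemma Ck_at_sum k u (J : Type) (s : seq J) (P : pred J) (F : J -> V -> R^o) :
  (forall j, P j -> Ck_at k u (F j)) ->
  Ck_at k u (fun z => \sum_(j <- s | P j) F j z : R^o).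
Proof.
move=> H; elim: s => [|j s IH].
  by under eq_fun do rewrite big_nil; exact: Ck_at_cst.
under eq_fun do rewrite big_cons.
case Pj: (P j); last exact: IH.
by apply: Ck_at_add => //; exact: H.
Qed.

Lemma Ck_at_opp k u f : Ck_at k u f -> Ck_at k u (fun z => - f z).
Proof.
move=> H; have := Ck_at_mul (Ck_at_cst k u (-1 : R^o)) H.
by under eq_fun do rewrite mulN1r.
Qed.

Lemma Ck_at_sub k u f g :
  Ck_at k u f -> Ck_at k u g -> Ck_at k u (fun z => f z - g z).
Proof. by move=> ? /Ck_at_opp; exact: Ck_at_add. Qed.

End RealValued.

(** * Chain rule, composition with linear maps *)

Section LinearComp.
Variables (R : realType) (V W : normedModType R).

Lemma diff_comp_at (V' : normedModType R) (g : V' -> V) (f : V -> W) z v :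
  differentiable g z -> differentiable f (g z) ->
  'd (f \o g) z v = 'd f (g z) ('d g z v).
Proof. by move=> dg df; exact: (congr1 (fun h => h v) (diff_comp dg df)). Qed.

Lemma diff_lin_at (L : {linear V -> W}) z v : continuous L -> 'd L z v = L v.
Proof. by move=> cL; exact: (congr1 (fun h => h v) (diff_lin z cL)). Qed.

End LinearComp.

Section LinearComp2.
Variables (R : realType) (V W : normedModType R).

(** The derivative of [f o L] along [v] is the derivative of [f] along the fixed vector [L v],
    composed with [L]. The induction thus closes without coordinates, and [V] may be any normed
    space, such as the product in [Ck_diag]. *)
Lemma Ck_comp_linear (V' : normedModType R) (L : {linear V' -> V})
    k (U' : set V') (U : set V) (f : V -> W) :
  continuous L -> open U' -> (forall z, U' z -> U (L z)) ->
  Ck k U f -> Ck k U' (fun z => f (L z)).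
Proof.
move=> cL oU' LU; elim: k f => [|k IH] f.
  move=> Cf u Uu; apply: (@continuous_comp _ _ _ L f); first exact: cL.
  exact: Cf (LU _ Uu).
move=> [df Cf]; split=> [u Uu|v].
  apply: differentiable_comp; last exact: df (LU _ Uu).
  exact: linear_differentiable.
apply: Ck_eq (IH _ (Cf (L v))) => // z Uz /=.
apply: esym; apply: etrans (diff_comp_at _ _ _) _.
- exact: linear_differentiable.
- exact: df (LU _ Uz).
- exact: (congr1 (fun w => 'd f (L z) w) (diff_lin_at z v cL)).
Qed.

Lemma diffZl_at (h : V -> R^o) (w : W) z v : differentiable h z ->
  'd (fun z => h z *: w) z v = 'd h z v *: w.
Proof. by move=> dh; exact: (congr1 (fun h => h v) (diffZl w dh)). Qed.

Lemma Ck_scalel k U (h : V -> R^o) (w : W) : open U ->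
  Ck k U h -> Ck k U (fun z => h z *: w).
Proof.
move=> oU; elim: k h => [|k IH] h.
  by move=> Ch u Uu; apply: cvgZr_tmp; exact: Ch Uu.
move=> [dh Ch]; split=> [u Uu|v].
  by apply: differentiableZl; exact: dh.
apply: Ck_eq (IH _ (Ch v)) => // z Uz.
exact: esym (diffZl_at w v (dh z Uz)).
Qed.

End LinearComp2.

(** * Coordinates of row vectors and composition of C^k maps *)

Section RowVectors.
Variables (R : realType).
Implicit Types (n k : nat).

Definition coordL n (j : 'I_n) : 'rV[R]_n -> R^o := fun u => u 0 j.

Lemma coordL_linear n j : linear (@coordL n j).
Proof. by move=> a u v; rewrite /coordL !mxE. Qed.
HB.instance Definition _ n j :=
  GRing.isLinear.Build R 'rV[R]_n R^o _ (@coordL n j) (@coordL_linear n j).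

Lemma coordL_continuous n j : continuous (@coordL n j).
Proof. exact: coord_continuous. Qed.

Lemma diff_coord_at (V : normedModType R) n (F : V -> 'rV[R]_n) j z v :
  differentiable F z -> 'd (fun z => F z 0 j : R^o) z v = ('d F z v) 0 j.
Proof.
move=> dF; apply: etrans (diff_comp_at (f := coordL j) _ dF _) _.
  by apply: linear_differentiable; exact: coordL_continuous.
by apply: etrans (diff_lin_at _ _ _) _; first exact: coordL_continuous.
Qed.

Lemma differentiable_rowcoord (V : normedModType R) n (F : V -> 'rV[R]_n) j z :
  differentiable F z -> differentiable (fun z => F z 0 j : R^o) z.
Proof.
move=> dF; apply: (differentiable_comp (g := coordL j)) => //.
by apply: linear_differentiable; exact: coordL_continuous.
Qed.

Lemma Ck_coord (V : normedModType R) n k (U : set V) (F : V -> 'rV[R]_n) j :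
  open U -> Ck k U F -> Ck k U (fun z => F z 0 j : R^o).
Proof.
move=> oU; elim: k F => [|k IH] F.
  move=> CF u Uu; apply: (@continuous_comp _ _ _ F (coordL j)).
    exact: CF.
  exact: coordL_continuous.
move=> [dF CF]; split=> [u Uu|v].
  by apply: differentiable_rowcoord; exact: dF.
apply: Ck_eq (IH _ (CF v)) => // z Uz.
exact: esym (diff_coord_at j v (dF z Uz)).
Qed.

Lemma Ck_at_coord (V : normedModType R) n k u (F : V -> 'rV[R]_n) j :
  Ck_at k u F -> Ck_at k u (fun z => F z 0 j : R^o).
Proof.
move=> /Ck_at_exP[U [oU Uu CU]]; apply/Ck_at_exP; exists U; split=> //.
exact: Ck_coord.
Qed.

Lemma Ck_at_scalel (V W : normedModType R) k u (h : V -> R^o) (w : W) :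
  Ck_at k u h -> Ck_at k u (fun z => h z *: w).
Proof.
move=> /Ck_at_exP[U [oU Uu CU]]; apply/Ck_at_exP; exists U; split=> //.
exact: Ck_scalel.
Qed.

Lemma Ck_at_row (V : normedModType R) n k u (F : V -> 'rV[R]_n) :
  (forall j, Ck_at k u (fun z => F z 0 j : R^o)) -> Ck_at k u F.
Proof.
move=> H; rewrite (_ : F = fun z => \sum_(j <- enum 'I_n) F z 0 j *: delta_mx 0 j).
  elim: (enum 'I_n) => [|j s IH].
    by under eq_fun do rewrite big_nil; exact: Ck_at_cst.
  under eq_fun do rewrite big_cons.
  by apply: Ck_at_add IH; apply: Ck_at_scalel.
by apply/funext => z; rewrite [LHS]row_sum_delta big_enum.
Qed.

Lemma diff_coords n (W : normedModType R) (f : 'rV[R]_n -> W) u v :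
  'd f u v = \sum_(j < n) v 0 j *: 'd f u (delta_mx 0 j).
Proof.
by rewrite {1}(row_sum_delta v) linear_sum; apply: eq_bigr => j _; rewrite linearZ.
Qed.

(** The direction ['d g z v] varies with [z], while [Ck] differentiates along fixed directions.
    Expanding it in the standard basis of the middle space turns the chain rule into a sum of
    products, to which the induction hypothesis applies. *)
Lemma Ck_comp (V : normedModType R) n k (U : set V) (U' : set 'rV[R]_n)
    (g : V -> 'rV[R]_n) (f : 'rV[R]_n -> R^o) :
  open U -> (forall z, U z -> U' (g z)) ->
  Ck k U g -> Ck k U' f -> Ck k U (fun z => f (g z)).
Proof.
move=> oU gU; elim: k f g gU => [|k IH] f g gU.
  move=> Cg Cf u Uu; apply: (@continuous_comp _ _ _ g f); first exact: Cg.
  exact: Cf (gU _ Uu).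
move=> Cg' [df Cf]; have [dg Cg] := Cg'; split=> [u Uu|v].
  apply: differentiable_comp; first exact: dg.
  exact: df (gU _ Uu).
pose h z : R^o := \sum_(j < n) ('d g z v) 0 j * 'd f (g z) (delta_mx 0 j).
apply: (@Ck_eq _ _ _ k U h) => // [z Uz|].
  apply: esym; apply: etrans (diff_comp_at _ (dg z Uz) (df _ (gU _ Uz))) _.
  exact: diff_coords.
apply/(Ck_atP _ _ oU) => u Uu; apply: Ck_at_sum => j _; apply: Ck_at_mul.
  by apply: Ck_at_coord; apply: ((Ck_atP _ _ oU).1 (Cg v)).
apply: ((Ck_atP _ _ oU).1 _ u Uu); apply: IH (CkS Cg') (Cf _) => //.
Qed.

Lemma Ck_at_comp (V : normedModType R) n k u
    (g : V -> 'rV[R]_n) (f : 'rV[R]_n -> R^o) :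
  {for u, continuous g} -> Ck_at k u g -> Ck_at k (g u) f ->
  Ck_at k u (fun z => f (g z)).
Proof.
move=> cg /Ck_at_exP[U [oU Uu CU]] /Ck_at_exP[U' [oU' Uu' CU']].
have /cg N : nbhs (g u) U' by exact: open_nbhs_nbhs.
apply/Ck_at_exP; exists (U `&` (g @^-1` U')°); split.
- by apply: openI => //; exact: open_interior.
- by split.
apply: (@Ck_comp _ _ _ _ U') => //.
- by apply: openI => //; exact: open_interior.
- by move=> z [_ /interior_subset].
- by apply: Ck_sub CU => z [].
Qed.

Definition diagL n : 'rV[R]_n -> 'rV[R]_n * 'rV[R]_n := fun u => (u, u).
Lemma diagL_linear n : linear (@diagL n).
Proof. by []. Qed.
HB.instance Definition _ n :=
  GRing.isLinear.Build R 'rV[R]_n ('rV[R]_n * 'rV[R]_n)%type _ (@diagL n) (@diagL_linear n).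

(** Restricts to the diagonal the functions of two points in [smooth_components]: the operators only
    involve H(x,x) and Gamma(x,x). *)
Lemma Ck_diag n k (U : set 'rV[R]_n) (U' : set ('rV[R]_n * 'rV[R]_n))
   (f : 'rV[R]_n * 'rV[R]_n -> R^o) :
  open U -> (forall z, U z -> U' (z, z)) -> Ck k U' f ->
  Ck k U (fun z => f (z, z)).
Proof.
move=> oU UU' Cf.
have cL : continuous (@diagL n).
  move=> z; apply: differentiable_continuous.
  exact: (@differentiable_pair R _ _ _ id id z).
exact: (@Ck_comp_linear R _ _ _ (@diagL n) k U U' f cL oU UU' Cf).
Qed.

End RowVectors.

(** * Cutoff functions of finite class on the real line *)

Section Cutoff.
Variable R : realType.
Implicit Types (t : R) (k : nat).

(** The truncated power of exponent k+1 is of class C^k, which makes it a finite-order substitute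
    for exp(-1/t). *)
Definition pospow k t : R := Num.max 0 t ^+ k.

Lemma pospow1_continuous : continuous (pospow 1 : R^o -> R^o).
Proof.
move=> t; apply: (@continuous_max R R^o (cst 0) id t); first exact: cvg_cst.
exact: cvg_id.
Qed.

Lemma is_derive_pospow2 t : is_derive t 1 (pospow 2 : R^o -> R^o) (2 * pospow 1 t).
Proof.
have [t0|t0|->] := ltgtP t 0.
- apply: (near_eq_is_derive (f := cst 0)).
    near=> z; rewrite /pospow max_l ?expr0n//; apply: ltW.
    by near: z; exact: lt_nbhsl.
  by rewrite /pospow max_l ?(ltW t0)// expr1 mulr0; exact: is_derive_cst.
- apply: (near_eq_is_derive (f := (id : R^o -> R^o) * (id : R^o -> R^o))).
    near=> z; rewrite /pospow fctE max_r ?expr2 //; apply: ltW.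
    by near: z; exact: lt_nbhsr.
  rewrite /pospow max_r ?(ltW t0)// expr1.
  have idt : is_derive (t : R^o) (1 : R^o) id (1 : R^o) by exact: is_derive_id.
  apply: (is_derive_eq (is_deriveM idt idt)).
  by rewrite /GRing.scale /= mulr1; ring.
(* At the corner the difference quotient with increment [h] is [pospow 1 h], which tends to 0. *)
- have E : (fun h : R => h^-1 *: ((pospow 2 \o shift 0) (h *: (1 : R^o)) - pospow 2 0 : R^o))
      @ 0^' --> (0 : R^o).
    have c0 : pospow 1 @ 0^' --> (0 : R^o).
      have p0 : pospow 1 0 = 0 by rewrite /pospow maxxx expr1.
      apply: cvg_within_filter; have := @pospow1_continuous 0.
      by rewrite /continuous_at p0.
    apply: cvg_trans c0; apply: near_eq_cvg; near=> h.
    have h0 : h != 0 by near: h; exact: nbhs_dnbhs_neq.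
    rewrite /= /pospow /= addr0 maxxx expr0n subr0 scaler1 expr1.
    have [h1|h1] := leP h 0.
      by rewrite expr0n /= scaler0.
    by rewrite expr2 /GRing.scale /= mulrA mulVf ?mul1r.
  rewrite {2}/pospow maxxx expr1 mulr0; split; first by apply/cvg_ex; exists 0.
  by apply/cvg_lim.
Unshelve. all: by end_near. Qed.

(** Only the square requires a difference quotient at 0; higher exponents follow by the product
    rule, a truncated power being [t] times the previous one. *)
Lemma is_derive_pospow k t :
  is_derive t 1 (pospow k.+2 : R^o -> R^o) (k.+2%:R * pospow k.+1 t).
Proof.
elim: k => [|k IH]; first exact: is_derive_pospow2.
have E : pospow k.+3 = (id : R^o -> R^o) * (pospow k.+2 : R^o -> R^o).
  apply/funext => z; rewrite fctE /pospow.
  have [z0|z0] := leP z 0; first by rewrite !expr0n mulr0.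
  by rewrite exprS.
rewrite E; apply: is_derive_eq; rewrite /= /GRing.scale /= mulr1 /pospow.
have [z0|z0] := leP t 0; first by rewrite !expr0n /= !mulr0 addr0.
by rewrite !exprS -[k.+3%:R]natr1; ring.
Qed.

Lemma pospow_continuous k : continuous (pospow k.+1 : R^o -> R^o).
Proof.
case: k => [|k] t; first exact: pospow1_continuous.
apply: differentiable_continuous; apply/derivable1_diffP.
by have [] := is_derive_pospow k t.
Qed.

Lemma Ck_pospow (V : normedModType R) k (U : set V) (f : V -> R^o) :
  open U -> Ck k U f -> Ck k U (fun z => pospow k.+1 (f z) : R^o).
Proof.
move=> oU; elim: k f => [|k IH] f Cf.
  move=> u Uu; apply: (@continuous_comp _ _ _ f (pospow 1 : R^o -> R^o)).
    exact: Cf.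
  exact: pospow_continuous.
have [df Cdf] := Cf.
have dp t : differentiable (pospow k.+2 : R^o -> R^o) t.
  by apply/derivable1_diffP; have [] := is_derive_pospow k t.
split=> [u Uu|v].
  by apply: differentiable_comp (dp _); exact: df.
apply: (@Ck_eq _ _ _ k U (fun z => k.+2%:R * pospow k.+1 (f z) * 'd f z v : R^o)) => //.
  move=> z Uz; apply: esym; apply: etrans (diff_comp_at v (df z Uz) (dp _)) _.
  have -> : 'd f z v = 'd f z v *: (1 : R^o) :> R^o by rewrite /GRing.scale /= mulr1.
  rewrite linearZ /= -(deriveE (1 : R^o) (dp _)).
  have [_ ->] := is_derive_pospow k (f z).
  by rewrite /GRing.scale /= mulr1 mulrC.
by apply: Ck_mul; [|apply: Ck_mul; [|exact: Ck_cst|exact: IH (CkS Cf)]|exact: Cdf].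
Qed.

Lemma Ck_at_pospow (V : normedModType R) k u (f : V -> R^o) :
  Ck_at k u f -> Ck_at k u (fun z => pospow k.+1 (f z) : R^o).
Proof.
move=> /Ck_at_exP[U [oU Uu CU]]; apply/Ck_at_exP; exists U; split=> //.
exact: Ck_pospow.
Qed.

(** For t <= 1 the inner power is at least 1, so the outer one vanishes; for t >= 2 the inner power
    vanishes and the outer one is 1. Nesting two truncated powers makes the function constant on
    both sides without any quotient. *)
Definition cutoff k t : R := 1 - pospow k.+1 (1 - pospow k.+1 (2 - t)).

Lemma cutoff_eq1 k t : t <= 1 -> cutoff k t = 1.
Proof.
move=> t1; rewrite /cutoff [X in _ - X](_ : _ = 0) ?subr0 //.
rewrite /pospow max_l ?expr0n // subr_le0 max_r; last by lra.
by rewrite exprn_ege1 //; lra.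
Qed.

Lemma cutoff_eq0 k t : 2 <= t -> cutoff k t = 0.
Proof.
move=> t2; rewrite /cutoff /pospow (@max_l _ _ _ (2 - t)); last by lra.
by rewrite expr0n /= subr0 max_r ?expr1n ?subrr//.
Qed.

Lemma Ck_at_cutoff (V : normedModType R) k u (f : V -> R^o) :
  Ck_at k u f -> Ck_at k u (fun z => cutoff k (f z) : R^o).
Proof.
move=> Cf; apply: Ck_at_sub; first exact: Ck_at_cst.
apply: Ck_at_pospow; apply: Ck_at_sub; first exact: Ck_at_cst.
by apply: Ck_at_pospow; apply: Ck_at_sub => //; exact: Ck_at_cst.
Qed.

End Cutoff.

(** * Symmetry of second derivatives *)

Section Schwarz.
Variables (R : realType) (V : normedModType R).
Implicit Types (f : V -> R^o).

Lemma is_derive_line f (w b : V) (t : R) : differentiable f (w + t *: b) ->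
  is_derive (t : R^o) (1 : R^o) (fun s : R^o => f (w + s *: b))
    ('d f (w + t *: b) b).
Proof.
move=> df; pose l (s : R^o) : V := w + s *: b.
have dl : is_diff (t : R^o) l ( *:%R ^~ b).
  by apply: is_diff_eq; rewrite add0r.
have dfl : differentiable (f \o l) (t : R^o).
  by apply: differentiable_comp => //; exact: ex_diff.
apply: DeriveDef; first exact: diff_derivable.
rewrite deriveE // (diff_comp_at _ (ex_diff (f := l)) df).
by rewrite diff_val scale1r.
Qed.

Lemma mean_value_line f (w b : V) (h : R) : 0 < h ->
  (forall t, 0 <= t <= h -> differentiable f (w + t *: b)) ->
  exists2 t, 0 <= t <= h & f (w + h *: b) - f w = 'd f (w + t *: b) b * h.
Proof.
move=> h0 df.
have [||t tI] := @MVT_segment R (fun s : R^o => f (w + s *: b))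
    (fun t => 'd f (w + t *: b) b) 0 h (ltW h0).
- move=> t tI; apply: is_derive_line; apply: df.
  by move: tI; rewrite in_itv /= => /andP[/ltW -> /ltW ->].
- apply: derivable_within_continuous => t tI.
  have /is_derive_line[] // : differentiable f (w + t *: b).
  by apply: df; move: tI; rewrite in_itv.
rewrite scale0r addr0 subr0 => E; exists t => //.
Qed.

(** The mean value theorem is used along [a] for z -> f(z + hb) - f(z), then along [b] for the
    derivative of [f] along [a]. The left-hand side is symmetric in [a] and [b], although the
    right-hand side is not visibly so. *)
Lemma second_difference f (u a b : V) (h : R) (U : set V) : 0 < h ->
  (forall s t, 0 <= s <= h -> 0 <= t <= h -> U (u + s *: a + t *: b)) ->
  (forall z, U z -> differentiable f z) ->
  (forall z, U z -> differentiable (fun z => 'd f z a) z) ->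
  exists s t, [/\ 0 <= s <= h, 0 <= t <= h &
    f (u + h *: a + h *: b) - f (u + h *: a) - (f (u + h *: b) - f u)
    = 'd (fun z => 'd f z a) (u + s *: a + t *: b) b * h * h].
Proof.
move=> h0 Uh df ddf.
have hh : 0 <= h <= h by rewrite lexx ltW.
have h00 : 0 <= (0 : R) <= h by rewrite lexx ltW.
pose phi z : R^o := f (z + h *: b) - f z.
have dshift z : differentiable (fun z : V => z + h *: b) z.
  by apply: differentiableD; [exact: ex_diff|exact: differentiable_cst].
have dphi s : 0 <= s <= h -> differentiable phi (u + s *: a) /\
    'd phi (u + s *: a) a
     = 'd f (u + s *: a + h *: b) a - 'd f (u + s *: a) a.
  move=> sI.
  have d1 : differentiable f (u + s *: a + h *: b) by apply/df/Uh.
  have d2 : differentiable f (u + s *: a).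
    by have := df _ (Uh s 0 sI h00); rewrite scale0r addr0.
  have d3 : differentiable (fun z => f (z + h *: b)) (u + s *: a).
    exact: (differentiable_comp (dshift _)).
  split; first exact: differentiableB.
  have -> : 'd phi (u + s *: a) a
     = 'd (fun z => f (z + h *: b)) (u + s *: a) a - 'd f (u + s *: a) a.
    exact: (congr1 (fun g => g a) (diffB d3 d2)).
  congr (_ - _).
  have -> : 'd (fun z => f (z + h *: b)) (u + s *: a) a =
     'd f (u + s *: a + h *: b) ('d (fun z : V => z + h *: b) (u + s *: a) a).
    exact: (diff_comp_at a (dshift _)).
  congr ('d f _ _).
  have E := diffD (@ex_diff _ _ _ _ _ _ _ (is_diff_id (u + s *: a)))
    (differentiable_cst (h *: b) (u + s *: a)).
  have -> : 'd (fun z : V => z + h *: b) (u + s *: a) a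
    = 'd (id : V -> V) (u + s *: a) a + 'd (cst (h *: b) : V -> V) (u + s *: a) a.
    exact: (congr1 (fun g => g a) E).
  by rewrite diff_cst addr0 diff_val.
have [|s sI Es] := @mean_value_line phi u a h h0.
  by move=> t /dphi[].
have [|t tI Et] := @mean_value_line (fun z => 'd f z a) (u + s *: a) b h h0.
  by move=> t tI; apply: ddf; exact: Uh.
exists s, t; split => //; rewrite -Et.
by move: Es; rewrite (dphi s sI).2.
Qed.

(** By the symmetry of [second_difference], the two mixed derivatives [P] and [Q] take a common
    value at points arbitrarily close to [u]; both are continuous at [u]. *)
Lemma diff_symmetric f u a b : Ck_at 2 u f ->
  'd (fun z => 'd f z a) u b = 'd (fun z => 'd f z b) u a.
Proof.
move=> Cf.
pose P z : R^o := 'd (fun z => 'd f z a) z b.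
pose Q z : R^o := 'd (fun z => 'd f z b) z a.
have cP : P z @[z --> u] --> P u.
  by have := nbhs_singleton (Ck_at_d b (Ck_at_d a Cf)); exact.
have cQ : Q z @[z --> u] --> Q u.
  by have := nbhs_singleton (Ck_at_d a (Ck_at_d b Cf)); exact.
apply/eqP; rewrite -subr_eq0 -normr_le0; apply/ler_addgt0Pl => e e0.
rewrite addr0.
have e2 : 0 < e / 2 by rewrite divr_gt0.
have /cvgrPdist_le/(_ _ e2) NP := cP.
have /cvgrPdist_le/(_ _ e2) NQ := cQ.
pose G := [set z | [/\ `|P u - P z| <= e / 2, `|Q u - Q z| <= e / 2,
  differentiable f z & differentiable (fun z => 'd f z a) z /\
                       differentiable (fun z => 'd f z b) z]].
have NG : nbhs u G.
  near=> z; split; [by near: z|by near: z| |].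
  - by apply: (@Ck_at_diff _ _ _ 1); near: z; exact: Ck_at_near.
  - have Cz : Ck_at 2 z f by near: z; exact: Ck_at_near.
    by split; apply: (@Ck_at_diff _ _ _ 0); exact: Ck_at_d.
have [r r0 rG] : exists2 r : R, 0 < r & forall z, `|u - z| < r -> G z.
  have [r /= r0 rG] := (nbhs_ballP _ _).1 NG.
  by exists r => // z zr; apply: rG; rewrite -ball_normE.
(* The summand 1 keeps [m] positive when a = b = 0. With this [h] the whole parallelogram spanned by
   ha and hb stays within r/2 of [u]. *)
pose m := `|a| + `|b| + 1.
have m0 : 0 < m by rewrite /m ltr_pwDr // addr_ge0.
pose h := r / m / 2.
have h0 : 0 < h by rewrite /h !divr_gt0.
have Gst s t : 0 <= s <= h -> 0 <= t <= h -> G (u + s *: a + t *: b).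
  move=> /andP[s0 sh] /andP[t0 th]; apply: rG.
  rewrite -addrA opprD addNKr normrN.
  apply: le_lt_trans (ler_normD _ _) _; rewrite !normrZ !ger0_norm //.
  apply: (@le_lt_trans _ _ (h * m)).
    rewrite /m mulrDr mulr1 mulrDr.
    have := ler_wpM2r (normr_ge0 a) sh; have := ler_wpM2r (normr_ge0 b) th.
    by move: (ltW h0); lra.
  have -> : h * m = r / 2 by rewrite /h; field; rewrite gt_eqF.
  by lra.
have [||s [t [sI tI E1]]] := @second_difference f u a b h G h0 Gst.
- by move=> z [].
- by move=> z [_ _ _ []].
have Gst' s' t' : 0 <= s' <= h -> 0 <= t' <= h -> G (u + s' *: b + t' *: a).
  by move=> ? ?; rewrite addrAC; exact: Gst.
have [||s' [t' [sI' tI' E2]]] := @second_difference f u b a h G h0 Gst'.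
- by move=> z [].
- by move=> z [_ _ _ []].
have [H1 _ _ _] := Gst s t sI tI.
have [_ H2 _ _] := Gst' s' t' sI' tI'.
(* Both values, multiplied by h^2, are the same second difference of [f]. *)
have E : P (u + s *: a + t *: b) = Q (u + s' *: b + t' *: a).
  have hn : h != 0 by rewrite gt_eqF.
  apply: (mulIf hn); apply: (mulIf hn); rewrite -E1 -E2.
  rewrite (addrAC u (h *: b) (h *: a)).
  by set A := f _; set B := f _; set C := f _; set D := f _; ring.
rewrite -/(P u) -/(Q u).
rewrite E in H1.
set q := Q (_ + _) in H1 H2.
have -> : P u - Q u = (P u - q) - (Q u - q) by ring.
apply: le_trans (ler_normB _ _) _.
by rewrite [leRHS](splitr e) lerD.
Unshelve. all: by end_near. Qed.

End Schwarz.

(** * C^k functions on the manifold, partial derivatives, bump functions *)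

Section ManifoldFunctions.
Variables (R : realType) (n : nat) (M : manifold R n).
Implicit Types (x z : M) (i j : cidx M) (k : nat).

(** The basic transfer from the manifold to a chart. The last two clauses are carried along because
    [chartV i] inverts [chart i] only on the image of the chart. *)
Lemma nbhs_chartV i x (P : set M) : cdom i x -> nbhs x P ->
  \forall u \near chart i x,
    [/\ P (chartV i u), cdom i (chartV i u) & chart i (chartV i u) = u].
Proof.
move=> ix NP; have oi := @cimg_open _ _ M i.
have xi : (chart i @` cdom i) (chart i x) by exists x.
have N1 : nbhs (chartV i (chart i x)) P by rewrite chartK.
have := chartV_continuous xi N1.
have : nbhs (chart i x) (chart i @` cdom i) by exact: open_nbhs_nbhs.
apply: filterS2 => u [z iz <-] Pu; split=> //; last by rewrite chartK.
by rewrite chartK.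
Qed.

Lemma nbhs_chart i x (P : set 'rV[R]_n) : cdom i x -> nbhs (chart i x) P ->
  \forall z \near x, P (chart i z).
Proof. by move=> ix NP; have := chart_continuous ix NP. Qed.

Lemma nbhs_cdom i x : cdom i x -> nbhs x (cdom i).
Proof. by move=> ix; apply: open_nbhs_nbhs; split=> //; exact: cdom_open. Qed.

Definition mCk_at (W : normedModType R) k (f : M -> W) x :=
  forall i, cdom i x -> Ck_at k (chart i x) (f \o chartV i).

Lemma mCkP (W : normedModType R) k (U : set M) (f : M -> W) : open U ->
  mCk k U f <-> forall x, U x -> mCk_at k f x.
Proof.
move=> oU; split=> [CU x Ux i ix|H i].
  have NU : nbhs x U by exact: open_nbhs_nbhs.
  apply: filterS (nbhs_chartV ix NU) => u [Uu iu Eu].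
  by apply: Ck_sub (CU i) => _ -> /=; exists (chartV i u).
apply: Ck_point => _ [x [ix Ux] <-].
exact: nbhs_singleton (H x Ux i ix).
Qed.

Lemma Ck_at_transition i j x k : cdom i x -> cdom j x ->
  Ck_at k (chart i x) (chart j \o chartV i).
Proof.
move=> ix jx; apply: filterS (nbhs_chartV ix (nbhs_cdom jx)) => u [ju iu Eu].
apply: Ck_sub (chart_smooth i j k) => _ -> /=.
by exists (chartV i u).
Qed.

Lemma transition_continuous i j x : cdom i x -> cdom j x ->
  {for chart i x, continuous (chart j \o chartV i)}.
Proof. by move=> ix jx; exact: nbhs_singleton (Ck_at_transition 0 ix jx) _ erefl. Qed.

Lemma mCk_at_eq (W : normedModType R) k (f g : M -> W) x :
  (\forall z \near x, f z = g z) -> mCk_at k f x -> mCk_at k g x.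
Proof.
move=> fg Cf i ix; apply: Ck_at_eq (Cf i ix).
by apply: filterS (nbhs_chartV ix fg) => u [].
Qed.

Lemma mCk_at_le (W : normedModType R) k k' (f : M -> W) x :
  (k <= k')%N -> mCk_at k' f x -> mCk_at k f x.
Proof. by move=> kk Cf i ix; exact: Ck_at_le (Cf i ix). Qed.

(** One chart around [x] decides regularity: in another chart the function is locally composed with
    a smooth transition map. *)
Lemma mCk_at_chart k (f : M -> R^o) i x : cdom i x ->
  Ck_at k (chart i x) (f \o chartV i) -> mCk_at k f x.
Proof.
move=> ix Cf j jx.
have E : (chart i \o chartV j) (chart j x) = chart i x by rewrite /= chartK.
apply: (@Ck_at_eq _ _ _ _ _ (fun u => (f \o chartV i) ((chart i \o chartV j) u))).
  apply: filterS (nbhs_chartV jx (nbhs_cdom ix)) => u [iu ju Eu] /=.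
  by rewrite chartK.
apply: Ck_at_comp.
- exact: transition_continuous.
- exact: Ck_at_transition.
- by rewrite E.
Qed.

Lemma mCk_at_nbhs k (f : M -> R^o) x : mCk_at k f x -> \forall z \near x, mCk_at k f z.
Proof.
move=> Cf; pose i := chart_at x; have ix : cdom i x := chart_atP x.
have := nbhs_chart ix (Ck_at_near (Cf i ix)).
have := nbhs_cdom ix; apply: filterS2 => z iz Cz.
exact: mCk_at_chart Cz.
Qed.

Lemma mCk_at_cst (W : normedModType R) k (a : W) x : mCk_at k (fun=> a) x.
Proof. by move=> i ix; exact: Ck_at_cst. Qed.

Lemma mCk_at_add k (f g : M -> R^o) x : mCk_at k f x -> mCk_at k g x ->
  mCk_at k (fun z => f z + g z) x.
Proof. by move=> Cf Cg i ix; apply: Ck_at_add (Cf i ix) (Cg i ix). Qed.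

Lemma mCk_at_mul k (f g : M -> R^o) x : mCk_at k f x -> mCk_at k g x ->
  mCk_at k (fun z => f z * g z : R^o) x.
Proof. by move=> Cf Cg i ix; apply: Ck_at_mul (Cf i ix) (Cg i ix). Qed.

Lemma mCk_at_sub k (f g : M -> R^o) x : mCk_at k f x -> mCk_at k g x ->
  mCk_at k (fun z => f z - g z) x.
Proof. by move=> Cf Cg i ix; apply: Ck_at_sub (Cf i ix) (Cg i ix). Qed.

Lemma mCk_at_sum k (J : Type) (s : seq J) (P : pred J) (F : J -> M -> R^o) x :
  (forall l, P l -> mCk_at k (F l) x) ->
  mCk_at k (fun z => \sum_(l <- s | P l) F l z : R^o) x.
Proof. by move=> H i ix; apply: Ck_at_sum => l Pl; exact: (H l Pl i ix). Qed.

Lemma mCk_at_coord m k (F : M -> 'rV[R]_m) x (l : 'I_m) :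
  mCk_at k F x -> mCk_at k (fun z => F z 0 l : R^o) x.
Proof. by move=> H i ix; exact: (Ck_at_coord l (H i ix)). Qed.

Lemma mCk_at_row m k (F : M -> 'rV[R]_m) x :
  (forall l, mCk_at k (fun z => F z 0 l : R^o) x) -> mCk_at k F x.
Proof. by move=> H i ix; apply: Ck_at_row => l; exact: (H l i ix). Qed.

Lemma Ck_at_id k (u : 'rV[R]_n) : Ck_at k u id.
Proof.
apply: filterE => z; case: k => [|k]; first by move=> t _; exact: cvg_id.
split=> [t _|v]; first exact: ex_diff.
apply: (eq_ind _ (Ck k _) (Ck_cst k [set z] v)); apply/funext => t.
by rewrite diff_val.
Qed.

Lemma mCk_at_chart_coord k i x (a : 'I_n) : cdom i x ->
  mCk_at k (fun z => chart i z 0 a : R^o) x.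
Proof.
move=> ix; apply: (mCk_at_chart ix); apply: (@Ck_at_coord _ _ _ _ _ (chart i \o chartV i)).
apply: Ck_at_eq (Ck_at_id k _).
by apply: filterS (nbhs_chartV ix (nbhs_cdom ix)) => u [_ _ /=].
Qed.

Lemma diff_of_mCk_at k (f : M -> R^o) i x : cdom i x -> mCk_at k.+1 f x ->
  differentiable (f \o chartV i) (chart i x).
Proof. by move=> ix /(_ i ix) /Ck_at_diff. Qed.

Lemma pderiv_eq i a (f g : M -> R^o) x : cdom i x -> mCk_at 1 f x ->
  (\forall z \near x, f z = g z) -> pderiv i a f x = pderiv i a g x.
Proof.
move=> ix Cf fg.
have N : \forall u \near chart i x, (f \o chartV i) u = (g \o chartV i) u.
  by apply: filterS (nbhs_chartV ix fg) => u [].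
have [_ E] := near_eq_diff N (diff_of_mCk_at ix Cf).
exact: esym (congr1 (fun h => h (delta_mx 0 a)) E).
Qed.

Lemma pderiv_cst i a (c : R^o) x : pderiv i a (fun=> c) x = 0.
Proof. by rewrite /pderiv; exact: (congr1 (fun h => h _) (diff_cst c _)). Qed.

Lemma pderivD i a (f g : M -> R^o) x : cdom i x -> mCk_at 1 f x -> mCk_at 1 g x ->
  pderiv i a (fun z => f z + g z) x = pderiv i a f x + pderiv i a g x.
Proof.
by move=> ix Cf Cg; exact: (diffD_at _ (diff_of_mCk_at ix Cf) (diff_of_mCk_at ix Cg)).
Qed.

Lemma pderivM i a (f g : M -> R^o) x : cdom i x -> mCk_at 1 f x -> mCk_at 1 g x ->
  pderiv i a (fun z => f z * g z : R^o) x
  = f x * pderiv i a g x + g x * pderiv i a f x.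
Proof.
move=> ix Cf Cg; rewrite /pderiv.
have := (diffM_at (delta_mx 0 a) (diff_of_mCk_at ix Cf) (diff_of_mCk_at ix Cg)).
by rewrite /= chartK.
Qed.

Lemma pderiv_sum i a (J : Type) (s : seq J) (F : J -> M -> R^o) x :
  cdom i x -> (forall l, mCk_at 1 (F l) x) ->
  pderiv i a (fun z => \sum_(l <- s) F l z : R^o) x
  = \sum_(l <- s) pderiv i a (F l) x.
Proof.
move=> ix H; elim: s => [|l s IH].
  by under eq_fun do rewrite big_nil; rewrite big_nil; exact: pderiv_cst.
under eq_fun do rewrite big_cons.
rewrite big_cons -IH; apply: pderivD => //.
exact: mCk_at_sum.
Qed.

Lemma pderiv_coord i a b x : cdom i x ->
  pderiv i a (fun z => chart i z 0 b : R^o) x = (a == b)%:R.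
Proof.
move=> ix.
have N : \forall u \near chart i x, coordL b u = ((fun z => chart i z 0 b : R^o) \o chartV i) u.
  by apply: filterS (nbhs_chartV ix (nbhs_cdom ix)) => u [_ _ /= ->].
have dc u : differentiable (@coordL R n b) u.
  by apply: linear_differentiable; exact: coordL_continuous.
have [_ E] := near_eq_diff N (dc _).
apply: etrans (congr1 (fun h => h (delta_mx 0 a)) E) _.
apply: etrans (diff_lin_at _ _ (@coordL_continuous R n b)) _.
by rewrite /= /coordL mxE eqxx eq_sym.
Qed.

Lemma pderiv_chartV i a (f : M -> R^o) x : cdom i x ->
  \forall u \near chart i x, 'd (f \o chartV i) u (delta_mx 0 a)
    = (pderiv i a f \o chartV i) u.
Proof.
move=> ix; apply: filterS (nbhs_chartV ix (nbhs_cdom ix)) => u [_ iu Eu] /=.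
by rewrite /pderiv Eu.
Qed.

Lemma mCk_at_pderiv k i a (f : M -> R^o) x : cdom i x -> mCk_at k.+1 f x ->
  mCk_at k (pderiv i a f : M -> R^o) x.
Proof.
move=> ix Cf; apply: (mCk_at_chart ix).
apply: Ck_at_eq (Ck_at_d (delta_mx 0 a) (Cf i ix)).
exact: pderiv_chartV.
Qed.

Lemma pderiv_sym i a b (f : M -> R^o) x : cdom i x -> mCk_at 2 f x ->
  pderiv i a (pderiv i b f) x = pderiv i b (pderiv i a f) x.
Proof.
move=> ix Cf.
have H c d : pderiv i c (pderiv i d f) x =
    'd (fun u => 'd (f \o chartV i) u (delta_mx 0 d)) (chart i x) (delta_mx 0 c).
  have [_ E] := near_eq_diff (pderiv_chartV d f ix)
    (Ck_at_diff (Ck_at_d (delta_mx 0 d) (Cf i ix))).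
  exact: (congr1 (fun h => h (delta_mx 0 c)) E).
rewrite !H; exact: diff_symmetric (Cf i ix).
Qed.

(** [vder] is defined in the chart attached to [x], which changes with [x]. The chain rule through
    the transition map moves it to a fixed chart, as is needed before differentiating once more. *)
Lemma vder_chart i (V : vfield M) (f : M -> R^o) x : cdom i x -> mCk_at 1 f x ->
  vder V f x = \sum_(a < n) vcomp i V x 0 a * pderiv i a f x.
Proof.
move=> ix Cf; rewrite /vder; set c := chart_at x.
have cx : cdom c x := chart_atP x.
have E : (chart i \o chartV c) (chart c x) = chart i x by rewrite /= chartK.
have N : \forall u \near chart c x,
    ((f \o chartV i) \o (chart i \o chartV c)) u = (f \o chartV c) u.
  apply: filterS (nbhs_chartV cx (nbhs_cdom ix)) => u [iu cu Eu] /=.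
  by rewrite chartK.
have dt : differentiable (chart i \o chartV c) (chart c x).
  exact: Ck_at_diff (Ck_at_transition 1 cx ix).
have df : differentiable (f \o chartV i) ((chart i \o chartV c) (chart c x)).
  by rewrite E; exact: diff_of_mCk_at ix Cf.
have [_ D] := near_eq_diff N (differentiable_comp dt df).
apply: etrans (congr1 (fun h => h (V x)) D) _.
apply: etrans (diff_comp_at _ dt df) _.
by rewrite E; exact: diff_coords.
Qed.

Lemma vder_eq (V : vfield M) (f g : M -> R^o) x : mCk_at 1 f x ->
  (\forall z \near x, f z = g z) -> vder V f x = vder V g x.
Proof.
move=> Cf fg; have cx := chart_atP x.
rewrite (vder_chart V cx Cf) (vder_chart V cx (mCk_at_eq fg Cf)).
by apply: eq_bigr => a _; rewrite (pderiv_eq a cx Cf fg).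
Qed.

Lemma vder_cst (V : vfield M) (c : R^o) x : vder V (fun=> c) x = 0.
Proof. by rewrite /vder; exact: (congr1 (fun h => h _) (diff_cst c _)). Qed.

Lemma vsmooth_comp (V : vfield M) k i x a : vsmooth V -> cdom i x ->
  mCk_at k (fun z => vcomp i V z 0 a : R^o) x.
Proof.
move=> sV ix; apply: mCk_at_coord.
exact: ((mCkP _ _ (@cdom_open _ _ M i)).1 (sV k i)).
Qed.

(** A radial cutoff in the chart at [x0], extended by 0. The third clause says more than vanishing
    outside [W]: it gives regularity of products with functions controlled only on [W]. *)
Lemma bump k x0 (W : set M) : nbhs x0 W ->
  exists b : M -> R^o, [/\ forall x, mCk_at k b x, \forall z \near x0, b z = 1
    & forall x, ~ W x -> \forall z \near x, b z = 0].
Proof.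
move=> NW; pose i := chart_at x0; have ix : cdom i x0 := chart_atP x0.
pose u0 := chart i x0.
have [e /= e0 He] := (nbhs_ballP _ _).1 (nbhs_chartV ix NW).
have {}He u : `|u0 - u| < e ->
    [/\ W (chartV i u), cdom i (chartV i u) & chart i (chartV i u) = u].
  by move=> ue; apply: He; rewrite -ball_normE.
(* The sum of squares replaces the norm of row vectors, a maximum that is not differentiable. The
   factor 8/e^2 is such that q u < 2, outside of which the cutoff vanishes, forces every coordinate
   of u - u0 below e/2 in absolute value. *)
pose q (u : 'rV[R]_n) : R^o := \sum_(a < n) (u - u0) 0 a ^+ 2 * (8 / e ^+ 2).
have Cq u : Ck_at k u q.
  apply: Ck_at_sum => a _; apply: Ck_at_mul; last exact: Ck_at_cst.
  have H : Ck_at k u (fun u : 'rV[R]_n => (u - u0) 0 a : R^o).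
    by apply: (@Ck_at_coord _ _ _ _ _ (fun u => u - u0)); apply: Ck_at_add (Ck_at_id _ _) (Ck_at_cst _ _ _).
  have := Ck_at_mul H H; apply: Ck_at_eq; exact: filterE.
have qK u : q u < 2 -> `|u0 - u| <= e / 2.
  move=> qu; rewrite distrC [leLHS]mx_normrE; apply: bigmax_le => [|[j a] _ /=].
    by rewrite divr_ge0 // ltW.
  rewrite ord1 -(@ler_pXn2r _ 2) ?nnegrE ?divr_ge0 // ?(ltW e0) //.
  rewrite real_normK ?num_real //.
  have e2 : 0 < e ^+ 2 by rewrite exprn_gt0.
  have : (u - u0) 0 a ^+ 2 * (8 / e ^+ 2) < 2.
    apply: le_lt_trans qu; rewrite /q (bigD1 a) //= lerDl; apply: sumr_ge0 => b _.
    by rewrite mulr_ge0 ?sqr_ge0 // divr_ge0 // ltW.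
  rewrite mulrA ltr_pdivrMr // expr_div_n => H.
  by move: H; set s := _ ^+ 2; set t := e ^+ 2; lra.
pose K := chartV i @` [set u | `|u0 - u| <= e / 2].
have elt : e / 2 < e by rewrite ltr_pdivrMr // ltr_pMr // ltr1n.
have Kle u : `|u0 - u| <= e / 2 -> `|u0 - u| < e by move/le_lt_trans; apply.
(* The Hausdorff axiom enters here: [K] is the image of a compact ball, hence closed in the whole
   manifold. So the extension by 0 vanishes near every point outside [K], including boundary points
   of the chart domain. *)
have cK : closed K.
  apply: compact_closed; first exact: manifold_hausdorff.
  apply: continuous_compact.
    apply: continuous_in_subspaceT => u; rewrite inE => /= /Kle /He[_ iu Eu].
    by apply: chartV_continuous; exists (chartV i u).
  apply: bounded_closed_compact.
    exists (`|u0| + e / 2); split; first exact: num_real.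
    move=> r rlt u /= ule; apply: le_trans (ltW rlt).
    have -> : u = u0 - (u0 - u) by rewrite opprB addrC subrK.
    by apply: le_trans (ler_normB _ _) _; rewrite lerD2l.
  have := @closed_ball_closed R 'rV[R]_n u0 (e / 2).
  by rewrite closed_ballE ?divr_gt0.
pose b z : R^o := if `[< cdom i z >] then cutoff k (q (chart i z)) else 0.
have b0 x : ~ K x -> \forall z \near x, b z = 0.
  move=> nKx; have : nbhs x (~` K) by apply: open_nbhs_nbhs; split=> //; exact: closed_openC.
  apply: filterS => z nKz; rewrite /b; case: asboolP => // iz.
  apply: cutoff_eq0; rewrite leNgt; apply/negP => /qK H.
  by apply: nKz; exists (chart i z) => //; rewrite chartK.
exists b; split.
- move=> x; have [Kx|nKx] := EM (K x); last first.
    apply: (@mCk_at_eq _ k (fun=> 0 : R^o)); last exact: mCk_at_cst.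
    by apply: filterS (b0 x nKx) => z ->.
  have {Kx} xi : cdom i x by case: Kx => u /= /Kle /He[_ ? _] <-.
  apply: (mCk_at_chart xi).
  apply: Ck_at_eq (Ck_at_cutoff (Cq (chart i x))).
  apply: filterS (nbhs_chartV xi (nbhs_cdom xi)) => u [_ iu Eu] /=.
  by rewrite /b; case: asboolP => // _; rewrite Eu.
- have qu0 : q u0 = 0.
    rewrite /q big1 // => a _; rewrite subrr mxE expr0n /= mul0r //.
  have cq : {for u0, continuous q}.
    exact: nbhs_singleton (Ck_at_le (leq0n k) (Cq u0)) _ erefl.
  have : \forall u \near u0, q u < 1.
    have N1 : nbhs (q u0) [set t : R | t < 1].
      by rewrite qu0; exact: lt_nbhsl ltr01.
    exact: cq N1.
  move/(nbhs_chart ix); have := nbhs_cdom ix; apply: filterS2 => z iz qz.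
  by rewrite /b; case: asboolP => // _; exact: cutoff_eq1 (ltW qz).
- move=> x nWx; apply: b0 => -[u /Kle /He[Wu _ _] ux].
  by apply: nWx; rewrite -ux.
Qed.

End ManifoldFunctions.

(** * Vector fields in coordinates *)

Section Fields.
Variables (R : realType) (n : nat) (M : manifold R n).
Implicit Types (x z : M) (i j : cidx M) (k : nat) (V : vfield M).

Lemma diff_transitionK i j x v : cdom i x -> cdom j x ->
  'd (chart j \o chartV i) (chart i x)
    ('d (chart i \o chartV j) (chart j x) v) = v.
Proof.
move=> ix jx.
have E : (chart i \o chartV j) (chart j x) = chart i x by rewrite /= chartK.
have N : \forall u \near chart j x, id u =
    ((chart j \o chartV i) \o (chart i \o chartV j)) u.
  apply: filterS (nbhs_chartV jx (nbhs_cdom ix)) => u [iu ju Eu] /=.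
  by rewrite chartK.
have d1 : differentiable (chart i \o chartV j) (chart j x).
  exact: Ck_at_diff (Ck_at_transition 1 jx ix).
have d2 : differentiable (chart j \o chartV i) ((chart i \o chartV j) (chart j x)).
  by rewrite E; exact: Ck_at_diff (Ck_at_transition 1 ix jx).
have did : differentiable (id : 'rV[R]_n -> _) (chart j x) by exact: ex_diff.
have [_ D] := near_eq_diff N did.
have := diff_comp_at v d1 d2; rewrite E => <-.
by rewrite D diff_val.
Qed.

Lemma vcomp_cfield i a x : cdom i x ->
  vcomp i (cfield i a) x = delta_mx 0 a.
Proof.
move=> ix; rewrite /vcomp /cfield; case: asboolP => // _.
by rewrite diff_transitionK //; exact: chart_atP.
Qed.

Lemma vfield_cfield i V x : cdom i x ->
  V x = \sum_(a < n) vcomp i V x 0 a *: cfield i a x.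
Proof.
move=> ix; have cx := chart_atP x.
rewrite -[LHS](@diff_transitionK i (chart_at x) x (V x) ix cx).
rewrite diff_coords; apply: eq_bigr => a _; congr (_ *: _).
by rewrite /cfield; case: asboolP.
Qed.

(** Turns a local function into a global one of the same class, the only kind of coefficient that
    the axioms of the connection accept. *)
Lemma mCk_at_glue k (b f : M -> R^o) (W : set M) :
  (forall x, mCk_at k b x) -> (forall x, ~ W x -> \forall z \near x, b z = 0) ->
  (forall x, W x -> mCk_at k f x) -> forall x, mCk_at k (fun z => b z * f z : R^o) x.
Proof.
move=> Cb b0 Cf x; have [Wx|nWx] := EM (W x); first exact: mCk_at_mul (Cf x Wx).
apply: (@mCk_at_eq _ _ _ _ k (fun=> 0 : R^o)); last exact: mCk_at_cst.
by apply: filterS (b0 x nWx) => z ->; rewrite mul0r.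
Qed.

Lemma mCkTP k (f : M -> R^o) : (forall x, mCk_at k f x) -> mCk k setT f.
Proof. by move=> Cf; apply/mCkP => [|x _]; [exact: openT|exact: Cf]. Qed.

End Fields.

(** * Sections of a bundle and their components *)

Section Sections.
Variables (R : realType) (n : nat) (M : manifold R n) (r : nat).
Variable E : vbundle M r.
Implicit Types (x z : M) (k : nat) (p q : tidx E) (T : sec E).

Definition scomp p T (l : 'I_r) : M -> R^o := fun z => triv p z (T z) 0 l.

Definition Csec_at k T x := forall p, tdom p x -> forall l, mCk_at k (scomp p T l) x.

Lemma CsecP k T : Csec k T <-> forall x, Csec_at k T x.
Proof.
split=> [CT x p px l|CT p].
  apply: (@mCk_at_coord _ _ _ _ _ (fun z => triv p z (T z))).
  exact: ((mCkP _ _ (tdom_open p)).1 (CT p)).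
apply/(mCkP _ _ (tdom_open p)) => x px.
by apply: mCk_at_row => l; exact: CT.
Qed.

Lemma nbhs_tdom p x : tdom p x -> nbhs x (tdom p).
Proof. by move=> px; apply: open_nbhs_nbhs; split=> //; exact: tdom_open. Qed.

Lemma Csec_at_eq k S T x : (\forall z \near x, S z = T z) ->
  Csec_at k S x -> Csec_at k T x.
Proof.
move=> ST CS p px l; apply: mCk_at_eq (CS p px l).
by apply: filterS ST => z; rewrite /scomp => ->.
Qed.

Lemma Csec_at0 k x : Csec_at k (fun=> 0) x.
Proof.
move=> p px l; apply: (@mCk_at_eq _ _ _ _ k (fun=> 0 : R^o)); last exact: mCk_at_cst.
by apply: filterE => z; rewrite /scomp linear0 mxE.
Qed.

Lemma Csec_at_scale k (f : M -> R^o) T x : mCk_at k f x -> Csec_at k T x ->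
  Csec_at k (fun z => f z *: T z) x.
Proof.
move=> Cf CT p px l; apply: mCk_at_eq (mCk_at_mul Cf (CT p px l)).
by apply: filterE => z; rewrite /scomp linearZ mxE.
Qed.

Lemma Csec_at_add k S T x : Csec_at k S x -> Csec_at k T x ->
  Csec_at k (fun z => S z + T z) x.
Proof.
move=> CS CT p px l; apply: mCk_at_eq (mCk_at_add (CS p px l) (CT p px l)).
by apply: filterE => z; rewrite /scomp linearD mxE.
Qed.

Lemma Csec_at_sum k (J : Type) (s : seq J) (F : J -> sec E) x :
  (forall j, Csec_at k (F j) x) -> Csec_at k (fun z => \sum_(j <- s) F j z) x.
Proof.
move=> H; elim: s => [|j s IH].
  apply: (@Csec_at_eq _ (fun=> 0)); last exact: Csec_at0.
  by apply: filterE => z; rewrite big_nil.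
apply: Csec_at_eq (Csec_at_add (H j) IH).
by apply: filterE => z; rewrite big_cons.
Qed.

Lemma scomp_frame p (l l' : 'I_r) x : tdom p x ->
  scomp p (lframe p l') l x = (l == l')%:R.
Proof. by move=> px; rewrite /scomp /lframe trivVK // mxE eqxx. Qed.

Lemma Csec_at_frame k p l x : tdom p x -> Csec_at k (lframe p l) x.
Proof.
move=> px q qx l'.
apply: (@mCk_at_coord _ _ _ _ _ (fun z => triv q z (lframe p l z))).
exact: ((mCkP _ _ (openI (tdom_open p) (tdom_open q))).1 (triv_smooth p q _ k)).
Qed.

Lemma frame_expand p T x : tdom p x ->
  T x = \sum_(l < r) scomp p T l x *: lframe p l x.
Proof.
move=> px; apply: (can_inj (trivK px)); rewrite linear_sum.
rewrite [LHS]row_sum_delta; apply: eq_bigr => l _.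
by rewrite linearZ /= /lframe trivVK.
Qed.

(** Frames are smooth in every other trivialization, so components in a single frame decide
    regularity. *)
Lemma Csec_at_of_frame k p T x : tdom p x -> (forall l, mCk_at k (scomp p T l) x) ->
  Csec_at k T x.
Proof.
move=> px H.
have C : Csec_at k (fun z => \sum_(l < r) scomp p T l z *: lframe p l z) x.
  by apply: Csec_at_sum => l; apply: Csec_at_scale => //; exact: Csec_at_frame.
apply: Csec_at_eq C; apply: filterS (nbhs_tdom px) => z pz.
by rewrite -frame_expand.
Qed.

(** Supplies global sections with the germs of the frame at [x], on which the connection can act. *)
Lemma frame_extension k p x : tdom p x ->
  exists F : 'I_r -> sec E, (forall l, Csec k (F l)) /\
    \forall z \near x, forall l, F l z = lframe p l z.
Proof.
move=> px; have [b [Cb b1 b0]] := bump k (nbhs_tdom px).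
exists (fun l z => b z *: lframe p l z); split=> [l|].
  apply/CsecP => z; have [pz|npz] := EM (tdom p z).
    by apply: Csec_at_scale => //; exact: Csec_at_frame.
  apply: (@Csec_at_eq _ (fun=> 0)); last exact: Csec_at0.
  by apply: filterS (b0 z npz) => w ->; rewrite scale0r.
by apply: filterS b1 => z -> l; rewrite scale1r.
Qed.

End Sections.

(** * Locality and local expression of the connection *)

Section Connections.
Variables (R : realType) (n : nat) (M : manifold R n) (r : nat).
Variables (Lam : Type) (xi : Lam -> vbundle M r).
Variables (I : transport xi) (N : connection I).
Implicit Types (a b : Lam) (x y z : M) (i : cidx M) (V : vfield M).

Lemma nab0 a b x V y : nab N b x V (fun z => 0 : xi a z) y = 0.
Proof.
have C0 : Csec 1 (fun z => 0 : xi a z) by apply/CsecP => z; exact: Csec_at0.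
have := nabD N b x V C0 C0 y.
have -> : (fun z => (0 : xi a z) + 0) = (fun z => 0 : xi a z).
  by apply: functional_extensionality_dep => z; rewrite addr0.
by move=> /eqP; rewrite -subr_eq subrr => /eqP.
Qed.

Lemma nab_sum a b x V (J : Type) (s : seq J) (F : J -> sec (xi a)) y :
  (forall j, Csec 1 (F j)) ->
  nab N b x V (fun z => \sum_(j <- s) F j z) y = \sum_(j <- s) nab N b x V (F j) y.
Proof.
move=> H; elim: s => [|j s IH].
  rewrite big_nil -[RHS](nab0 a b x V y); congr (nab N b x V _ y).
  by apply: functional_extensionality_dep => z; rewrite big_nil.
have Cs : Csec 1 (fun z => \sum_(j <- s) F j z).
  by apply/CsecP => z; apply: Csec_at_sum => l; move: z; apply/CsecP.
rewrite big_cons -IH -(nabD N b x V (H j) Cs y); congr (nab N b x V _ y).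
by apply: functional_extensionality_dep => z; rewrite big_cons.
Qed.

Lemma nabv0 a b x (T : sec (xi a)) y : Csec 1 T -> nab N b x (fun=> 0) T y = 0.
Proof.
move=> CT; have := nabDv N b x (fun=> 0) (fun=> 0) CT y.
under eq_fun do rewrite addr0.
by move=> /eqP; rewrite -subr_eq subrr => /eqP.
Qed.

Lemma nabv_sum a b x (T : sec (xi a)) (J : Type) (s : seq J) (F : J -> vfield M) y :
  Csec 1 T ->
  nab N b x (fun z => \sum_(j <- s) F j z) T y = \sum_(j <- s) nab N b x (F j) T y.
Proof.
move=> CT; elim: s => [|j s IH].
  rewrite big_nil -[RHS](nabv0 b x y CT); congr (nab N b x _ T y).
  by apply/funext => z; rewrite big_nil.
rewrite big_cons -IH -(nabDv N b x _ _ CT y); congr (nab N b x _ T y).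
by apply/funext => z; rewrite big_cons.
Qed.

Lemma nab_bump a b x V (f : M -> R^o) (T : sec (xi a)) y :
  (forall x, mCk_at 1 f x) -> (\forall z \near x, f z = 1) -> Csec 1 T ->
  nab N b x V (fun z => f z *: T z) y = nab N b x V T y.
Proof.
move=> Cf f1 CT; rewrite (nab_leibniz N b x V (mCkTP Cf) CT y).
have E : vder V f x = 0.
  by rewrite (vder_eq V (Cf x) f1) vder_cst.
by rewrite E scale0r linear0 add0r (nbhs_singleton f1) scale1r.
Qed.

(** Take a bump supported where [S] and [T] agree: its products with [S] and with [T] are equal
    everywhere. By the Leibniz rule, multiplication by a function equal to 1 near [x] does not
    change the value of the connection based at [x]. *)
Lemma nab_local a b x V (S T : sec (xi a)) y : Csec 1 S -> Csec 1 T ->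
  (\forall z \near x, S z = T z) -> nab N b x V S y = nab N b x V T y.
Proof.
move=> CS CT ST; have [f [Cf f1 f0]] := bump 1 ST.
rewrite -(nab_bump b V y Cf f1 CS) -(nab_bump b V y Cf f1 CT).
congr (nab N b x V _ y); apply: functional_extensionality_dep => z.
have [->//|/f0 /nbhs_singleton ->] := EM (S z = T z).
by rewrite !scale0r.
Qed.

(** By locality the set in the definition of [Gcomp] has at most one element, and [T] shows that it
    has one, so the default value 0 of [xget] does not occur. *)
Lemma GcompE a b i (p : tidx (xi a)) (q : tidx (xi b)) l k alpha y x
    (T : sec (xi a)) : Csec 1 T -> (\forall z \near x, T z = lframe p k z) ->
  Gcomp N i p q l k alpha y x = triv q y (nab N b x (cfield i alpha) T y) 0 l.
Proof.
move=> CT Tk; rewrite /Gcomp.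
set P := (X in xget 0 X).
have [S [CS Sk ->]] : P (xget 0 P).
  by apply: xgetPex; exists (triv q y (nab N b x (cfield i alpha) T y) 0 l), T.
congr (triv q y _ 0 l); apply: nab_local => //.
by move: Sk Tk; apply: filterS2 => z -> ->.
Qed.

(** Near [x] the section coincides with a global combination of the extended frame, whose
    coefficients are the cut off components. Locality, additivity and the Leibniz rule then
    apply. *)
Lemma nab_expand a b x V (p : tidx (xi a)) (T : sec (xi a)) F y :
  tdom p x -> Csec 1 T -> (forall l, Csec 1 (F l)) ->
  (\forall z \near x, forall l, F l z = lframe p l z) ->
  nab N b x V T y = \sum_(l < r)
    (tr I a b x y (vder V (scomp p T l) x *: lframe p l x)
     + scomp p T l x *: nab N b x V (F l) y).
Proof.
move=> px CT CF Fp; have [f [Cf f1 f0]] := bump 1 (nbhs_tdom px).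
have CTp z : tdom p z -> forall l, mCk_at 1 (scomp p T l) z.
  by move=> pz; exact: ((CsecP 1 T).1 CT z p pz).
pose g l z : R^o := f z * scomp p T l z.
have Cg l z : mCk_at 1 (g l) z by apply: (mCk_at_glue Cf f0) => w pw; exact: CTp.
have CgF l : Csec 1 (fun z => g l z *: F l z).
  apply/CsecP => z; apply: Csec_at_scale; first exact: Cg.
  exact: ((CsecP 1 (F l)).1 (CF l) z).
pose S z := \sum_(l < r) g l z *: F l z.
have CS : Csec 1 S.
  by apply/CsecP => z; apply: Csec_at_sum => l; exact: ((CsecP 1 _).1 (CgF l) z).
have ST : \forall z \near x, T z = S z.
  have := nbhs_tdom px; move: f1 Fp; apply: filterS3 => z fz Fz pz.
  rewrite [LHS](frame_expand _ pz); apply: eq_bigr => l _.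
  by rewrite /g fz mul1r Fz.
rewrite (nab_local b V y CT CS ST) (nab_sum b x V _ y CgF).
apply: eq_bigr => l _; rewrite (nab_leibniz N b x V (mCkTP (Cg l)) (CF l) y).
have gE : \forall z \near x, g l z = scomp p T l z.
  by apply: filterS f1 => z; rewrite /g => ->; rewrite mul1r.
rewrite (vder_eq V (Cg l x) gE) (nbhs_singleton gE).
by rewrite (nbhs_singleton Fp).
Qed.

(** Linearity in the field is axiomatised for globally C^1 coefficients, while the components of [V]
    live in one chart; multiplication by [f], with f(x) = 1, changes nothing at [x]. *)
Lemma nab_field a b x i V (T : sec (xi a)) y : cdom i x -> vsmooth V ->
  Csec 1 T -> nab N b x V T y =
    \sum_(c < n) vcomp i V x 0 c *: nab N b x (cfield i c) T y.
Proof.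
move=> ix sV CT; have [f [Cf f1 f0]] := bump 1 (nbhs_cdom ix).
pose g (c : 'I_n) z : R^o := f z * vcomp i V z 0 c.
have Cg c z : mCk_at 1 (g c) z.
  by apply: (mCk_at_glue Cf f0) => w iw; exact: vsmooth_comp.
have fx := nbhs_singleton f1.
have CfT := mCkTP Cf; have CgT c := mCkTP (Cg c).
(* One factor [f] cuts off the components, the other accompanies the coordinate fields. *)
have E1 : nab N b x (fun z => f z *: (f z *: V z)) T y = nab N b x V T y.
  rewrite (nabZv N b x (fun z => f z *: V z) CfT CT) (nabZv N b x V CfT CT).
  by rewrite fx !scale1r.
have E2 : (fun z => f z *: (f z *: V z))
    = (fun z => \sum_(c < n) g c z *: (f z *: cfield i c z)).
  apply/funext => z; have [iz|/f0 /nbhs_singleton f0z] := EM (cdom i z).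
    rewrite (vfield_cfield V iz) !scaler_sumr; apply: eq_bigr => c _.
    by rewrite !scalerA /g [in RHS]mulrAC.
  by rewrite f0z scale0r big1 // => c _; rewrite scale0r scaler0.
rewrite -E1 E2 (nabv_sum b x _ _ y CT); apply: eq_bigr => c _.
rewrite (nabZv N b x (fun z => f z *: cfield i c z) (CgT c) CT).
by rewrite (nabZv N b x (cfield i c) CfT CT) /g fx scale1r mul1r.
Qed.

Definition Hdiag a b (p : tidx (xi a)) (q : tidx (xi b)) l k : M -> R^o :=
  fun z => Hcomp I p q l k z z.
Definition Gdiag a b i (p : tidx (xi a)) (q : tidx (xi b)) l k c : M -> R^o :=
  fun z => Gcomp N i p q l k c z z.

Lemma nab_cfield_comp a b x i c (p : tidx (xi a)) (q : tidx (xi b))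
    (T : sec (xi a)) l :
  cdom i x -> tdom p x -> Csec 1 T ->
  scomp q (nabt N b (cfield i c) T) l x = \sum_(k < r)
    (Hdiag p q l k x * pderiv i c (scomp p T k) x + Gdiag i p q l k c x * scomp p T k x).
Proof.
move=> ix px CT; have [F [CF Fp]] := frame_extension 1 px.
rewrite /scomp /nabt (nab_expand _ _ _ px CT CF Fp) linear_sum summxE.
apply: eq_bigr => k _; rewrite linearD /= mxE linearZ /= linearZ /= mxE.
congr (_ + _).
  rewrite mulrC /Hdiag /Hcomp; congr (_ * _).
  have := (CsecP _ _).1 CT x p px k => Ck; rewrite (vder_chart _ ix Ck).
  rewrite vcomp_cfield // (bigD1 c) //= mxE !eqxx mul1r big1 ?addr0 // => d dc.
  by rewrite mxE (negPf dc) andbF mul0r.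
have Fk : \forall z \near x, F k z = lframe p k z by apply: filterS Fp.
by rewrite linearZ /= mxE mulrC /Gdiag (GcompE i q l c x (CF k) Fk).
Qed.

Lemma nab_comp a b x i V (p : tidx (xi a)) (q : tidx (xi b)) (T : sec (xi a)) l :
  cdom i x -> tdom p x -> vsmooth V -> Csec 1 T ->
  scomp q (nabt N b V T) l x = \sum_(c < n) vcomp i V x 0 c * \sum_(k < r)
    (Hdiag p q l k x * pderiv i c (scomp p T k) x + Gdiag i p q l k c x * scomp p T k x).
Proof.
move=> ix px sV CT; rewrite {1}/scomp /nabt (nab_field _ _ ix sV CT) linear_sum summxE.
apply: eq_bigr => c _; rewrite linearZ /= mxE; congr (_ * _).
by rewrite -nab_cfield_comp.
Qed.

Lemma Hdiag_id a (p : tidx (xi a)) l k x : tdom p x -> Hdiag p p l k x = (l == k)%:R.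
Proof. by move=> px; rewrite /Hdiag /Hcomp tr_id; exact: scomp_frame. Qed.

Lemma trd_comp a b (p : tidx (xi a)) (q : tidx (xi b)) (T : sec (xi a)) l x :
  tdom p x ->
  scomp q (trd I b T) l x = \sum_(k < r) Hdiag p q l k x * scomp p T k x.
Proof.
move=> px; rewrite {1}/scomp /trd {1}(frame_expand T px) !linear_sum summxE.
by apply: eq_bigr => k _; rewrite 2!linearZ mxE mulrC.
Qed.

Hypothesis hsmooth : smooth_components N.

Lemma mCk_at_Hdiag k a b (p : tidx (xi a)) (q : tidx (xi b)) l l' x :
  tdom p x -> tdom q x -> mCk_at k (Hdiag p q l l') x.
Proof.
move=> px qx; pose i := chart_at x; have ix : cdom i x := chart_atP x.
apply: (mCk_at_chart ix); apply/Ck_at_exP.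
pose P := [set z | tdom p z /\ tdom q z].
have NP : nbhs x P by move: (nbhs_tdom px) (nbhs_tdom qx); apply: filterS2.
pose U := [set u | [/\ P (chartV i u), cdom i (chartV i u)
                   & chart i (chartV i u) = u]].
have NU : nbhs (chart i x) U := nbhs_chartV ix NP.
exists U°; split; [exact: open_interior|exact: NU|].
have [CH _] := hsmooth i i p q l l'.
apply: (Ck_diag _ _ (CH k)); first exact: open_interior.
move=> u /interior_subset[[pu qu] iu Eu].
by split; exists (chartV i u).
Qed.

Lemma mCk_at_Gdiag k a b i (p : tidx (xi a)) (q : tidx (xi b)) l l' c x :
  cdom i x -> tdom p x -> tdom q x -> mCk_at k (Gdiag i p q l l' c) x.
Proof.
move=> ix px qx; apply: (mCk_at_chart ix); apply/Ck_at_exP.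
pose P := [set z | tdom p z /\ tdom q z].
have NP : nbhs x P by move: (nbhs_tdom px) (nbhs_tdom qx); apply: filterS2.
pose U := [set u | [/\ P (chartV i u), cdom i (chartV i u)
                   & chart i (chartV i u) = u]].
have NU : nbhs (chart i x) U := nbhs_chartV ix NP.
exists U°; split; [exact: open_interior|exact: NU|].
have [_ /(_ c) CH] := hsmooth i i p q l l'.
apply: (Ck_diag _ _ (CH k)); first exact: open_interior.
move=> u /interior_subset[[pu qu] iu Eu].
by split; exists (chartV i u).
Qed.

End Connections.

(** * Coordinate algebra of the commutator and of the curvatures *)

Section CommutatorAlgebra.
Variables (K : comNzRingType) (n r : nat).
Variables (h' : 'I_r -> K) (g' : 'I_r -> 'I_n -> K).
Variables (h : 'I_r -> 'I_r -> K) (dh : 'I_r -> 'I_r -> 'I_n -> K).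
Variables (g : 'I_r -> 'I_r -> 'I_n -> K) (dg : 'I_r -> 'I_r -> 'I_n -> 'I_n -> K).
Variables (B C : 'I_n -> K) (dB dC : 'I_n -> 'I_n -> K).
Variables (t0 : 'I_r -> K) (t1 : 'I_r -> 'I_n -> K) (t2 : 'I_r -> 'I_n -> 'I_n -> K).

(** Dictionary for this part: [h'], [g'] are H and Gamma from the second bundle to the third, with
    the upper index fixed; [h], [g] go from the first to the second. [dh l k b] and [dg l k a b] are
    derivatives along b, [dC b a] is the b-th derivative of the a-th component of C, and [t0], [t1],
    [t2] form the 2-jet of the section. *)
Definition first_order l k a : K := h l k * t1 k a + g l k a * t0 k.

(** The coefficient of nab_b nab_a for coordinate fields, without its second order term
    [h' l * h l k * t2 k b a]. *)
Definition comm_core l k b a : K :=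
  h' l * (dh l k b * t1 k a + g l k a * t1 k b + dg l k a b * t0 k)
  + g' l b * first_order l k a.

(** The absence of [t2] is the point: in this form the commutator is visibly a first order
    operator. *)
Definition comm_form : K := \sum_l \sum_k \sum_b \sum_a
  ((B b * C a - C b * B a) * comm_core l k b a
   + h' l * (B b * dC b a - C b * dB b a) * first_order l k a).

(** The component of nab_X nab_Y T; sums and products are arranged as the product rule delivers them
    in [pderiv_nab_form]. *)
Definition second_order (X Y : 'I_n -> K) (dY : 'I_n -> 'I_n -> K) : K :=
  \sum_b X b * \sum_l
    (h' l * (\sum_a (Y a * (\sum_k (h l k * t2 k b a + t1 k a * dh l k b
                                + (g l k a * t1 k b + t0 k * dg l k a b)))
                  + (\sum_k first_order l k a) * dY b a))
     + g' l b * \sum_a Y a * \sum_k first_order l k a).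

Lemma second_orderE X Y dY : second_order X Y dY =
  \sum_l \sum_k \sum_b \sum_a
   (X b * (h' l * (Y a * (h l k * t2 k b a + t1 k a * dh l k b
                                + (g l k a * t1 k b + t0 k * dg l k a b))
                  + first_order l k a * dY b a)
     + g' l b * (Y a * first_order l k a))).
Proof.
rewrite /second_order.
under eq_bigr => b _ do rewrite mulr_sumr.
rewrite exchange_big; apply: eq_bigr => l _ /=.
rewrite [RHS]exchange_big; apply: eq_bigr => b _ /=.
rewrite [RHS]exchange_big !mulr_sumr -big_split /= mulr_sumr.
apply: eq_bigr => a _.
rewrite mulr_sumr mulr_suml -big_split /= !mulr_sumr -big_split /= mulr_sumr.
by [].
Qed.

Lemma commutator_algebra :
  (forall k b a, t2 k b a = t2 k a b) ->
  second_order B C dC - second_order C B dB = comm_form.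
Proof.
move=> t2C; rewrite !second_orderE -sumrB; apply: eq_bigr => l _.
rewrite -sumrB; apply: eq_bigr => k _.
(* The second derivatives enter through an antisymmetric coefficient contracted with the symmetric
   [t2]. *)
have Z : \sum_b \sum_a h' l * h l k * (B b * C a - C b * B a) * t2 k b a = 0.
  under eq_bigr => b _ do (under eq_bigr => a _ do rewrite mulrBr mulrBl; rewrite sumrB).
  rewrite sumrB; apply/eqP; rewrite subr_eq0; apply/eqP.
  rewrite exchange_big; apply: eq_bigr => b _; apply: eq_bigr => a _ /=.
  by rewrite (t2C k a b); ring.
rewrite -[RHS]addr0 -[X in _ = _ + X]Z -sumrB -big_split; apply: eq_bigr => b _.
rewrite -sumrB -big_split; apply: eq_bigr => a _ /=.
by rewrite /comm_core /first_order; ring.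
Qed.

(** Separates the part that is tensorial in B and C, to be matched with R + D, from the part
    containing the bracket, to be matched with I o nab_[B,C]. The antisymmetrisation is moved from
    the fields onto [comm_core]. *)
Lemma comm_formE : comm_form =
  \sum_b \sum_a (B b * C a) * (\sum_k \sum_l (comm_core l k b a - comm_core l k a b))
  + \sum_l h' l * \sum_a (\sum_b (B b * dC b a - C b * dB b a)) * \sum_k first_order l k a.
Proof.
rewrite /comm_form.
have -> : \sum_l h' l * (\sum_a (\sum_b (B b * dC b a - C b * dB b a)) * \sum_k first_order l k a)
  = \sum_l \sum_k \sum_b \sum_a h' l * (B b * dC b a - C b * dB b a) * first_order l k a.
  apply: eq_bigr => l _; rewrite mulr_sumr.
  transitivity (\sum_a \sum_k \sum_b h' l * (B b * dC b a - C b * dB b a) * first_order l k a).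
    apply: eq_bigr => a _; rewrite mulr_sumr mulr_sumr; apply: eq_bigr => k _.
    by rewrite mulr_suml mulr_sumr; apply: eq_bigr => b _; rewrite mulrA.
  rewrite exchange_big; apply: eq_bigr => k _ /=.
  by rewrite exchange_big.
have -> : \sum_b \sum_a (B b * C a) * (\sum_k \sum_l (comm_core l k b a - comm_core l k a b))
  = \sum_l \sum_k \sum_b \sum_a (B b * C a - C b * B a) * comm_core l k b a.
  transitivity (\sum_l \sum_k \sum_b \sum_a B b * C a * (comm_core l k b a - comm_core l k a b)).
    transitivity (\sum_b \sum_a \sum_l \sum_k B b * C a * (comm_core l k b a - comm_core l k a b)).
      apply: eq_bigr => b _; apply: eq_bigr => a _.
      rewrite exchange_big mulr_sumr; apply: eq_bigr => l _.
      by rewrite mulr_sumr.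
    transitivity (\sum_b \sum_l \sum_k \sum_a B b * C a * (comm_core l k b a - comm_core l k a b)).
      apply: eq_bigr => b _; rewrite exchange_big; apply: eq_bigr => l _ /=.
      by rewrite exchange_big.
    rewrite exchange_big; apply: eq_bigr => l _ /=.
    by rewrite exchange_big.
  apply: eq_bigr => l _; apply: eq_bigr => k _.
  under eq_bigr => b _ do (under eq_bigr => a _ do rewrite mulrBr; rewrite sumrB).
  under [RHS]eq_bigr => b _ do (under eq_bigr => a _ do rewrite mulrBl; rewrite sumrB).
  rewrite !sumrB; congr (_ - _).
  rewrite exchange_big; apply: eq_bigr => b _; apply: eq_bigr => a _ /=.
  by rewrite [B a * _]mulrC.
rewrite -big_split; apply: eq_bigr => l _; rewrite -big_split; apply: eq_bigr => k _.
rewrite -big_split; apply: eq_bigr => b _; rewrite -big_split; apply: eq_bigr => a _.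
by [].
Qed.

(* The terms of R containing D are the zeroth order part of D applied to the connection [G] of the first bundle. *)
Lemma curvature_algebra (HG : 'I_r -> 'I_n -> 'I_n -> K)
    (D : 'I_r -> 'I_n -> 'I_n -> 'I_n -> K) (G : 'I_r -> 'I_r -> 'I_n -> K) :
  (forall k b a, HG k b a = \sum_l (h' l * dg l k a b + g' l b * g l k a)) ->
  (forall k c b a, D k c b a =
    \sum_l (h' l * (dh l k b * (c == a)%:R + g l k a * (c == b)%:R)
            + g' l b * h l k * (c == a)%:R)
    - \sum_l (h' l * (dh l k a * (c == b)%:R + g l k b * (c == a)%:R)
            + g' l a * h l k * (c == b)%:R)) ->
  \sum_k \sum_b \sum_a (HG k b a - HG k a b - \sum_l \sum_c D l c b a * G l k c)
      * t0 k * B b * C a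
  + \sum_k \sum_c \sum_b \sum_a D k c b a * (t1 k c + \sum_l G k l c * t0 l)
      * B b * C a
  = \sum_b \sum_a (B b * C a) * (\sum_k \sum_l (comm_core l k b a - comm_core l k a b)).
Proof.
move=> HGE DE.
have -> : \sum_k \sum_c \sum_b \sum_a D k c b a * (t1 k c + \sum_l G k l c * t0 l)
      * B b * C a = \sum_b \sum_a \sum_k \sum_c D k c b a * (t1 k c + \sum_l G k l c * t0 l)
      * B b * C a.
  transitivity (\sum_k \sum_b \sum_a \sum_c D k c b a * (t1 k c + \sum_l G k l c * t0 l)
      * B b * C a).
    apply: eq_bigr => k _; rewrite exchange_big; apply: eq_bigr => b _ /=.
    by rewrite exchange_big.
  rewrite exchange_big; apply: eq_bigr => b _ /=; by rewrite exchange_big.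
have -> : \sum_k \sum_b \sum_a (HG k b a - HG k a b - \sum_l \sum_c D l c b a * G l k c)
      * t0 k * B b * C a = \sum_b \sum_a \sum_k
      (HG k b a - HG k a b - \sum_l \sum_c D l c b a * G l k c) * t0 k * B b * C a.
  rewrite exchange_big; apply: eq_bigr => b _ /=; by rewrite exchange_big.
rewrite -big_split; apply: eq_bigr => b _; rewrite -big_split; apply: eq_bigr => a _ /=.
have E1 : \sum_k \sum_c D k c b a * (t1 k c + \sum_l G k l c * t0 l) =
   \sum_k \sum_c D k c b a * t1 k c + \sum_k (\sum_l \sum_c D l c b a * G l k c) * t0 k.
  transitivity (\sum_k (\sum_c D k c b a * t1 k c + \sum_c D k c b a * \sum_l G k l c * t0 l)).
    apply: eq_bigr => k _; rewrite -big_split; apply: eq_bigr => c _ /=.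
    by rewrite mulrDr.
  rewrite big_split /=; congr (_ + _).
  transitivity (\sum_k \sum_l \sum_c D k c b a * G k l c * t0 l).
    apply: eq_bigr => k _; rewrite exchange_big; apply: eq_bigr => c _ /=.
    by rewrite mulr_sumr; apply: eq_bigr => l _; rewrite mulrA.
  rewrite exchange_big; apply: eq_bigr => k _ /=.
  by rewrite mulr_suml; apply: eq_bigr => l _; rewrite mulr_suml.
(* The Kronecker symbols in D collapse the sum over the direction c, leaving the [t1] terms of
   [comm_core]. *)
have E2 k : \sum_c D k c b a * t1 k c = \sum_l
   (h' l * (dh l k b * t1 k a + g l k a * t1 k b) + g' l b * h l k * t1 k a)
   - \sum_l (h' l * (dh l k a * t1 k b + g l k b * t1 k a) + g' l a * h l k * t1 k b).
  have collapse (u v w : 'I_r -> K) d e :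
      \sum_c (\sum_l (u l * (v l * (c == d)%:R + w l * (c == e)%:R))) * t1 k c
      = \sum_l u l * (v l * t1 k d + w l * t1 k e).
    under eq_bigr => c _ do rewrite mulr_suml.
    rewrite exchange_big; apply: eq_bigr => l _ /=.
    have S d' (f : K) : \sum_c f * (c == d')%:R * t1 k c = f * t1 k d'.
      rewrite (bigD1 d') //= eqxx mulr1 big1 ?addr0 // => c cd.
      by rewrite (negPf cd) mulr0 mul0r.
    rewrite mulrDr !mulrA -!S -big_split; apply: eq_bigr => c _ /=; ring.
  have collapse3 (u v w y : 'I_r -> K) d e :
      \sum_c (\sum_l (u l * (v l * (c == d)%:R + w l * (c == e)%:R)
                      + y l * (c == d)%:R)) * t1 k c
      = \sum_l (u l * (v l * t1 k d + w l * t1 k e) + y l * t1 k d).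
    rewrite big_split /= -collapse.
    have -> : \sum_l y l * t1 k d =
       \sum_c (\sum_l (y l * (1 * (c == d)%:R + 0 * (c == d)%:R))) * t1 k c.
      by rewrite (collapse y (fun=> 1) (fun=> 0)); apply: eq_bigr => l _; ring.
    rewrite -big_split; apply: eq_bigr => c _ /=.
    rewrite -mulrDl -big_split; congr (_ * _); apply: eq_bigr => l _ /=; ring.
  rewrite -!(collapse3 h' (fun l => dh l k _) (fun l => g l k _) (fun l => g' l _ * h l k)).
  rewrite -sumrB; apply: eq_bigr => c _.
  by rewrite DE mulrBl.
have -> : \sum_k \sum_c D k c b a * (t1 k c + \sum_l G k l c * t0 l) * B b * C a
   = (\sum_k \sum_c D k c b a * (t1 k c + \sum_l G k l c * t0 l)) * (B b * C a).
  rewrite mulr_suml; apply: eq_bigr => k _; rewrite mulr_suml; apply: eq_bigr => c _.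
  by rewrite mulrA.
have -> : \sum_k (HG k b a - HG k a b - \sum_l \sum_c D l c b a * G l k c) * t0 k * B b * C a
  = (\sum_k (HG k b a - HG k a b - \sum_l \sum_c D l c b a * G l k c) * t0 k) * (B b * C a).
  by rewrite mulr_suml; apply: eq_bigr => k _; rewrite mulrA.
rewrite -mulrDl mulrC; congr (_ * _).
rewrite E1.
have -> : \sum_k (HG k b a - HG k a b - \sum_l \sum_c D l c b a * G l k c) * t0 k
  = \sum_k (HG k b a - HG k a b) * t0 k
    - \sum_k (\sum_l \sum_c D l c b a * G l k c) * t0 k.
  by rewrite -sumrB; apply: eq_bigr => k _; rewrite mulrBl.
rewrite addrCA subrK addrC -big_split; apply: eq_bigr => k _ /=.
rewrite E2 !HGE mulrBl !mulr_suml -!sumrB -big_split; apply: eq_bigr => l _ /=.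
by rewrite /comm_core /first_order; ring.
Qed.

End CommutatorAlgebra.

(** * The Lie bracket of vector fields *)

Section Bracket.
Variables (R : realType) (n : nat) (M : manifold R n).
Implicit Types (x z : M) (i : cidx M) (k : nat) (V : vfield M).

Definition vcoord i V (a : 'I_n) : M -> R^o := fun z => vcomp i V z 0 a.

Lemma mCk_at_vcoord k i V x a : vsmooth V -> cdom i x -> mCk_at k (vcoord i V a) x.
Proof. exact: vsmooth_comp. Qed.

Variables (B C : vfield M) (sB : vsmooth B) (sC : vsmooth C).

Definition bracket_comp i (a : 'I_n) : M -> R^o := fun z =>
  \sum_(b < n) (vcoord i B b z * pderiv i b (vcoord i C a) z
                - vcoord i C b z * pderiv i b (vcoord i B a) z).

Lemma vder_near V i (f : M -> R^o) x : cdom i x -> mCk_at 1 f x ->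
  \forall z \near x, vder V f z = \sum_(a < n) vcoord i V a z * pderiv i a f z.
Proof.
move=> ix Cf; have := mCk_at_nbhs Cf; have := nbhs_cdom ix.
by apply: filterS2 => z iz Cz; exact: vder_chart.
Qed.

Lemma mCk_at_vder V k i (f : M -> R^o) x : vsmooth V -> cdom i x -> mCk_at k.+1 f x ->
  mCk_at k (fun z => \sum_(a < n) vcoord i V a z * pderiv i a f z : R^o) x.
Proof.
move=> sV ix Cf; apply: mCk_at_sum => a _; apply: mCk_at_mul; first exact: mCk_at_vcoord.
exact: mCk_at_pderiv.
Qed.

Lemma vder_vder V W i (f : M -> R^o) x : vsmooth W -> cdom i x -> mCk_at 2 f x ->
  vder V (vder W f) x = \sum_(b < n) \sum_(a < n) vcoord i V b x *
    (vcoord i W a x * pderiv i b (pderiv i a f) x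
     + pderiv i a f x * pderiv i b (vcoord i W a) x).
Proof.
move=> sW ix Cf; have C1 := mCk_at_le (isT : (1 <= 2)%N) Cf.
have Cg := mCk_at_vder sW ix Cf.
have E := vder_near W ix C1.
have E' : \forall z \near x, \sum_(a < n) vcoord i W a z * pderiv i a f z = vder W f z.
  by apply: filterS E => z ->.
rewrite -(vder_eq V Cg E') (vder_chart V ix Cg); apply: eq_bigr => b _.
rewrite -mulr_sumr; congr (_ * _).
have Ca a : mCk_at 1 (vcoord i W a) x by exact: mCk_at_vcoord.
have Cp a : mCk_at 1 (pderiv i a f : M -> R^o) x by exact: mCk_at_pderiv.
apply: etrans (pderiv_sum b _ ix (fun a => mCk_at_mul (Ca a) (Cp a))) _.
by apply: eq_bigr => a _; exact: (pderivM b ix (Ca a) (Cp a)).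
Qed.

(** The defining property holds once some field satisfies it. The witness is the classical
    coordinate formula, evaluated at each point in the chart attached to that point; the second
    derivatives of [f] cancel by symmetry. *)
Lemma vbracketP (f : M -> R^o) x : mCk 2 setT f ->
  vder (vbracket B C) f x = vder B (vder C f) x - vder C (vder B f) x.
Proof.
move=> Cf; rewrite /vbracket; set P := (X in xget _ X).
suff : P (xget (fun=> 0 : 'rV[R]_n) P) by move/(_ f Cf x).
apply: xgetPex; exists (fun z => \row_a bracket_comp (chart_at z) a z).
move=> {f Cf x} f /(mCkP _ _ openT) Cf x; have ix := chart_atP x.
have {}Cf := Cf x I; rewrite (vder_vder B sC ix Cf) (vder_vder C sB ix Cf).
rewrite /vder diff_coords; set i := chart_at x.
transitivity (\sum_(a < n) bracket_comp i a x * pderiv i a f x).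
  by apply: eq_bigr => a _; rewrite mxE.
under eq_bigr => a _ do rewrite mulr_suml.
rewrite exchange_big /=.
have Z : \sum_(b < n) \sum_(a < n) vcoord i B b x * (vcoord i C a x * pderiv i b (pderiv i a f) x)
  = \sum_(b < n) \sum_(a < n) vcoord i C b x * (vcoord i B a x * pderiv i b (pderiv i a f) x).
  rewrite exchange_big; apply: eq_bigr => b _; apply: eq_bigr => a _ /=.
  by rewrite (pderiv_sym _ _ ix Cf) mulrCA.
apply/eqP; rewrite -subr_eq0; apply/eqP.
transitivity (\sum_(b < n) \sum_(a < n) vcoord i C b x * (vcoord i B a x * pderiv i b (pderiv i a f) x)
  - \sum_(b < n) \sum_(a < n) vcoord i B b x * (vcoord i C a x * pderiv i b (pderiv i a f) x));
  last by rewrite Z subrr.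
rewrite -!sumrB; apply: eq_bigr => b _; rewrite -!sumrB; apply: eq_bigr => a _.
move: (vcoord i C b x) (vcoord i B a x) (vcoord i B b x) (vcoord i C a x) => c b1 b2 c1.
move: (pderiv i b (pderiv i a f) x) (pderiv i a f x) => p2 p1.
move: (pderiv i b (vcoord i C a) x) (pderiv i b (vcoord i B a) x) => q1 q2.
by ring.
Qed.

(** The bracket is known only through its action on global C^2 functions. Testing it on a cut off
    coordinate function reads off a component, in any chart around [x]. *)
Lemma vcomp_vbracket i x a : cdom i x ->
  vcomp i (vbracket B C) x 0 a = bracket_comp i a x.
Proof.
move=> ix; have [b [Cb b1 b0]] := bump 2 (nbhs_cdom ix).
pose c z : R^o := chart i z 0 a.
have Cc k z : cdom i z -> mCk_at k c z by exact: mCk_at_chart_coord.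
pose f z : R^o := b z * c z.
have Cf z : mCk_at 2 f z by apply: (mCk_at_glue Cb b0) => w; exact: Cc.
have C1 z : mCk_at 1 f z := mCk_at_le (isT : (1 <= 2)%N) (Cf z).
(* The outer derivation needs the inner one at all points near [x], hence agreement of germs there
   and not only at [x]. *)
have fc : \forall z \near x, \forall w \near z, f w = c w.
  by apply: near_join; apply: filterS b1 => z bz; rewrite /f bz mul1r.
have vf V z : cdom i z -> (\forall w \near z, f w = c w) -> vder V f z = vcoord i V a z.
  move=> iz fcz; rewrite (vder_eq V (C1 z) fcz) (vder_chart V iz (Cc 1 z iz)).
  rewrite (bigD1 a) //= pderiv_coord // eqxx mulr1 big1 ?addr0 // => d da.
  by rewrite pderiv_coord // (negPf da) mulr0.
have vvf V W : vsmooth W -> vder V (vder W f) x =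
    \sum_(d < n) vcoord i V d x * pderiv i d (vcoord i W a) x.
  move=> sW; have Cw : mCk_at 1 (vcoord i W a) x by exact: mCk_at_vcoord.
  have E : \forall z \near x, vcoord i W a z = vder W f z.
    by move: (nbhs_cdom ix) fc; apply: filterS2 => z iz fcz; rewrite vf.
  by rewrite -(vder_eq V Cw E) (vder_chart V ix Cw).
have := vbracketP x (mCkTP Cf).
rewrite (vf _ x ix (nbhs_singleton fc)) !vvf // => E.
by rewrite -/(vcoord i (vbracket B C) a x) E -sumrB.
Qed.

Lemma mCk_at_bracket_comp k i a x : cdom i x -> mCk_at k (bracket_comp i a) x.
Proof.
move=> ix; apply: mCk_at_sum => b _; apply: mCk_at_sub; apply: mCk_at_mul.
- exact: mCk_at_vcoord.
- by apply: mCk_at_pderiv => //; exact: mCk_at_vcoord.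
- exact: mCk_at_vcoord.
- by apply: mCk_at_pderiv => //; exact: mCk_at_vcoord.
Qed.

Lemma vsmooth_vbracket : vsmooth (vbracket B C).
Proof.
move=> k i; apply/(mCkP _ _ (@cdom_open _ _ M i)) => x ix.
apply: mCk_at_row => a; apply: mCk_at_eq (mCk_at_bracket_comp k a ix).
by apply: filterS (nbhs_cdom ix) => z iz; rewrite vcomp_vbracket.
Qed.

End Bracket.

(** * Equality of first jets *)

Section Jets.
Variables (R : realType) (n : nat) (M : manifold R n).
Variables (i : cidx M) (x : M).
Hypothesis ix : cdom i x.
Implicit Types (f g : M -> R^o).

(** Regularity is part of the relation so that it is stable under sums and products. Equality of
    2-jets is later expressed by [same_jet1] for the components together with [same_jet1] for their
    first partial derivatives. *)
Definition same_jet1 f g := [/\ mCk_at 1 f x, mCk_at 1 g x, f x = g x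
  & forall a, pderiv i a f x = pderiv i a g x].

Lemma same_jet1_refl f : mCk_at 1 f x -> same_jet1 f f.
Proof. by []. Qed.

Lemma same_jet1_near f g f' g' : (\forall z \near x, f' z = f z) ->
  (\forall z \near x, g' z = g z) -> same_jet1 f' g' -> same_jet1 f g.
Proof.
move=> ff gg [Cf Cg E D]; split.
- exact: mCk_at_eq Cf.
- exact: mCk_at_eq Cg.
- by rewrite -(nbhs_singleton ff) -(nbhs_singleton gg).
- by move=> a; rewrite -(pderiv_eq a ix Cf ff) -(pderiv_eq a ix Cg gg).
Qed.

Lemma same_jet1_add f g f' g' : same_jet1 f f' -> same_jet1 g g' ->
  same_jet1 (fun z => f z + g z) (fun z => f' z + g' z).
Proof.
move=> [Cf Cf' Ef Df] [Cg Cg' Eg Dg]; split; [exact: mCk_at_add|exact: mCk_at_add| |].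
  by rewrite Ef Eg.
move=> a; apply: etrans (pderivD a ix Cf Cg) _.
by rewrite Df Dg -(pderivD a ix Cf' Cg').
Qed.

Lemma same_jet1_mul f g f' g' : same_jet1 f f' -> same_jet1 g g' ->
  same_jet1 (fun z => f z * g z : R^o) (fun z => f' z * g' z : R^o).
Proof.
move=> [Cf Cf' Ef Df] [Cg Cg' Eg Dg]; split; [exact: mCk_at_mul|exact: mCk_at_mul| |].
  by rewrite Ef Eg.
move=> a; apply: etrans (pderivM a ix Cf Cg) _.
by rewrite Df Dg Ef Eg -(pderivM a ix Cf' Cg').
Qed.

Lemma same_jet1_sum (J : Type) (s : seq J) (F G : J -> M -> R^o) :
  (forall j, same_jet1 (F j) (G j)) ->
  same_jet1 (fun z => \sum_(j <- s) F j z : R^o) (fun z => \sum_(j <- s) G j z : R^o).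
Proof.
move=> H; split.
- by apply: mCk_at_sum => j _; have [] := H j.
- by apply: mCk_at_sum => j _; have [] := H j.
- by apply: eq_bigr => j _; have [] := H j.
- move=> a; have CF j : mCk_at 1 (F j) x by have [] := H j.
  have CG j : mCk_at 1 (G j) x by have [] := H j.
  apply: etrans (pderiv_sum a s ix CF) _.
  apply: etrans (esym (pderiv_sum a s ix CG)).
  by apply: eq_bigr => j _; have [] := H j.
Qed.

End Jets.

(** * Second covariant derivatives and their commutator in a fixed chart *)

Section Curvature.
Variables (R : realType) (n : nat) (M : manifold R n) (r : nat).
Variables (Lam : Type) (xi : Lam -> vbundle M r).
Variables (I : transport xi) (N : connection I).
Hypothesis hsmooth : smooth_components N.
Implicit Types (x z : M) (i : cidx M) (V W B C : vfield M).

Lemma Csec_le (E : vbundle M r) k k' (T : sec E) :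
  (k <= k')%N -> Csec k' T -> Csec k T.
Proof.
move=> kk CT; apply/CsecP => x p px l.
exact: mCk_at_le kk ((CsecP k' T).1 CT x p px l).
Qed.

Lemma mCk_at_scomp (E : vbundle M r) k (T : sec E) p x l :
  Csec k T -> tdom p x -> mCk_at k (scomp p T l) x.
Proof. by move=> CT px; exact: ((CsecP k T).1 CT x p px l). Qed.

(** The local formula for nab_V in one chart and pair of frames, applied to arbitrary component
    functions; unlike the operator itself it can be differentiated by the product rule. *)
Definition nab_form a b i V (p : tidx (xi a)) (q : tidx (xi b))
    (t : 'I_r -> M -> R^o) l : M -> R^o := fun z =>
  \sum_(c < n) vcoord i V c z * \sum_(k < r)
    (Hdiag I p q l k z * pderiv i c (t k) z + Gdiag N i p q l k c z * t k z).

Lemma nabt_near a b i V (p : tidx (xi a)) (q : tidx (xi b)) (T : sec (xi a)) l x :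
  cdom i x -> tdom p x -> vsmooth V -> Csec 1 T ->
  \forall z \near x, nab_form i V p q (scomp p T) l z = scomp q (nabt N b V T) l z.
Proof.
move=> ix px sV CT; have := nbhs_tdom px; have := nbhs_cdom ix.
apply: filterS2 => z iz pz; exact: esym (nab_comp N q l iz pz sV CT).
Qed.

Lemma mCk_at_nab_form_term k a b i (p : tidx (xi a)) (q : tidx (xi b))
    (t : 'I_r -> M -> R^o) l c k' x :
  cdom i x -> tdom p x -> tdom q x -> mCk_at k.+1 (t k') x ->
  mCk_at k (fun z => Hdiag I p q l k' z * pderiv i c (t k') z
               + Gdiag N i p q l k' c z * t k' z : R^o) x.
Proof.
move=> ix px qx Ct; apply: mCk_at_add; apply: mCk_at_mul.
- exact: (mCk_at_Hdiag hsmooth).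
- exact: mCk_at_pderiv.
- exact: (mCk_at_Gdiag hsmooth).
- exact: mCk_at_le (leqnSn k) Ct.
Qed.

Lemma mCk_at_nab_form k a b i V (p : tidx (xi a)) (q : tidx (xi b))
    (t : 'I_r -> M -> R^o) l x :
  cdom i x -> tdom p x -> tdom q x -> vsmooth V ->
  (forall k', mCk_at k.+1 (t k') x) -> mCk_at k (nab_form i V p q t l) x.
Proof.
move=> ix px qx sV Ct; apply: mCk_at_sum => c _; apply: mCk_at_mul.
  exact: mCk_at_vcoord.
by apply: mCk_at_sum => k' _; exact: mCk_at_nab_form_term.
Qed.

Lemma Csec_nabt k a b V (T : sec (xi a)) : vsmooth V -> Csec k.+1 T ->
  Csec k (nabt N b V T).
Proof.
move=> sV CT; apply/CsecP => x.
pose i := chart_at x; have ix : cdom i x := chart_atP x.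
pose p := triv_at (xi a) x; have px : tdom p x := triv_atP (xi a) x.
pose q := triv_at (xi b) x; have qx : tdom q x := triv_atP (xi b) x.
apply: (Csec_at_of_frame qx) => l.
apply: mCk_at_eq (nabt_near q l ix px sV (Csec_le (ltn0Sn k) CT)) _.
by apply: mCk_at_nab_form => // k'; exact: mCk_at_scomp.
Qed.

Lemma pderiv_nab_form a b i V (p : tidx (xi a)) (q : tidx (xi b))
    (t : 'I_r -> M -> R^o) l d x :
  cdom i x -> tdom p x -> tdom q x -> vsmooth V -> (forall k, mCk_at 2 (t k) x) ->
  pderiv i d (nab_form i V p q t l) x = \sum_(c < n)
    (vcoord i V c x * (\sum_(k < r)
       (Hdiag I p q l k x * pderiv i d (pderiv i c (t k)) x
        + pderiv i c (t k) x * pderiv i d (Hdiag I p q l k) x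
        + (Gdiag N i p q l k c x * pderiv i d (t k) x
           + t k x * pderiv i d (Gdiag N i p q l k c) x)))
     + (\sum_(k < r) (Hdiag I p q l k x * pderiv i c (t k) x
                      + Gdiag N i p q l k c x * t k x)) * pderiv i d (vcoord i V c) x).
Proof.
move=> ix px qx sV Ct.
have CV c : mCk_at 1 (vcoord i V c) x by exact: mCk_at_vcoord.
have CH k : mCk_at 1 (Hdiag I p q l k) x by exact: (mCk_at_Hdiag hsmooth).
have CG k c : mCk_at 1 (Gdiag N i p q l k c) x by exact: (mCk_at_Gdiag hsmooth).
have Ct1 k : mCk_at 1 (t k) x by exact: mCk_at_le (Ct k).
have Cd k c : mCk_at 1 (pderiv i c (t k) : M -> R^o) x by exact: mCk_at_pderiv.
have Cs c : mCk_at 1 (fun z => \sum_(k < r)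
    (Hdiag I p q l k z * pderiv i c (t k) z + Gdiag N i p q l k c z * t k z) : R^o) x.
  by apply: mCk_at_sum => k _; exact: mCk_at_nab_form_term.
apply: etrans (pderiv_sum d _ ix (fun c => mCk_at_mul (CV c) (Cs c))) _.
apply: eq_bigr => c _; apply: etrans (pderivM d ix (CV c) (Cs c)) _.
congr (_ * _ + _ * _).
apply: etrans (pderiv_sum d _ ix (fun k => mCk_at_nab_form_term l c ix px qx (Ct k))) _.
apply: eq_bigr => k _.
apply: etrans (pderivD d ix (mCk_at_mul (CH k) (Cd k c)) (mCk_at_mul (CG k c) (Ct1 k))) _.
congr (_ + _); first exact: (pderivM d ix (CH k) (Cd k c)).
exact: (pderivM d ix (CG k c) (Ct1 k)).
Qed.

Section Commutator.
Variables (a b c : Lam) (i : cidx M).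
Variables (p : tidx (xi a)) (q : tidx (xi b)) (s : tidx (xi c)).

Lemma second_covariant_derivative V W (T : sec (xi a)) j x :
  cdom i x -> tdom p x -> tdom q x -> vsmooth V -> vsmooth W -> Csec 2 T ->
  scomp s (nabt N c V (nabt N b W T)) j x =
  second_order (fun l => Hdiag I q s j l x) (fun l d => Gdiag N i q s j l d x)
    (fun l k => Hdiag I p q l k x) (fun l k d => pderiv i d (Hdiag I p q l k) x)
    (fun l k d => Gdiag N i p q l k d x)
    (fun l k d e => pderiv i e (Gdiag N i p q l k d) x)
    (fun k => scomp p T k x) (fun k d => pderiv i d (scomp p T k) x)
    (fun k e d => pderiv i e (pderiv i d (scomp p T k)) x)
    (fun d => vcoord i V d x) (fun d => vcoord i W d x)
    (fun e d => pderiv i e (vcoord i W d) x).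
Proof.
move=> ix px qx sV sW CT.
have C1 : Csec 1 (nabt N b W T) by exact: Csec_nabt.
have CT1 : Csec 1 T by exact: Csec_le CT.
have Ct k : mCk_at 2 (scomp p T k) x by exact: mCk_at_scomp.
rewrite (nab_comp N s j ix qx sV C1); apply: eq_bigr => e _.
congr (_ * _); apply: eq_bigr => l _.
have E := nabt_near q l ix px sW CT1.
have Cf : mCk_at 1 (nab_form i W p q (scomp p T) l) x by exact: mCk_at_nab_form.
by rewrite -(pderiv_eq e ix Cf E) (pderiv_nab_form l e ix px qx sW Ct) -(nbhs_singleton E).
Qed.

(** The chart and frames do not depend on the point [x], contrary to those in [curvR] and
    [curvD]. *)
Definition comm_fun B C (t : 'I_r -> M -> R^o) j : M -> R^o := fun x =>
  comm_form (fun l => Hdiag I q s j l x) (fun l d => Gdiag N i q s j l d x)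
    (fun l k => Hdiag I p q l k x) (fun l k d => pderiv i d (Hdiag I p q l k) x)
    (fun l k d => Gdiag N i p q l k d x)
    (fun l k d e => pderiv i e (Gdiag N i p q l k d) x)
    (fun d => vcoord i B d x) (fun d => vcoord i C d x)
    (fun e d => pderiv i e (vcoord i B d) x)
    (fun e d => pderiv i e (vcoord i C d) x)
    (fun k => t k x) (fun k d => pderiv i d (t k) x).

Lemma commutator_comp B C (T : sec (xi a)) j x :
  cdom i x -> tdom p x -> tdom q x -> vsmooth B -> vsmooth C -> Csec 2 T ->
  scomp s (nabt N c B (nabt N b C T)) j x
  - scomp s (nabt N c C (nabt N b B T)) j x = comm_fun B C (scomp p T) j x.
Proof.
move=> ix px qx sB sC CT.
rewrite (second_covariant_derivative j ix px qx sB sC CT).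
rewrite (second_covariant_derivative j ix px qx sC sB CT).
apply: commutator_algebra => k e d; apply: pderiv_sym => //.
exact: mCk_at_scomp.
Qed.

(** [comm_fun] is a sum of products of C^1 coefficients with [t] and its first derivatives, so the
    2-jet of [t] determines its 1-jet. *)
Lemma same_jet1_comm_fun B C (t t' : 'I_r -> M -> R^o) j x :
  cdom i x -> tdom p x -> tdom q x -> tdom s x -> vsmooth B -> vsmooth C ->
  (forall k, same_jet1 i x (t k) (t' k)) ->
  (forall k d, same_jet1 i x (pderiv i d (t k)) (pderiv i d (t' k))) ->
  same_jet1 i x (comm_fun B C t j) (comm_fun B C t' j).
Proof.
move=> ix px qx sx sB sC Ht Hdt.
have JV V d : vsmooth V -> same_jet1 i x (vcoord i V d) (vcoord i V d).
  by move=> sV; apply: same_jet1_refl; exact: mCk_at_vcoord.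
have JdV V d e : vsmooth V ->
    same_jet1 i x (pderiv i e (vcoord i V d)) (pderiv i e (vcoord i V d)).
  by move=> sV; apply: same_jet1_refl; apply: mCk_at_pderiv => //; exact: mCk_at_vcoord.
have JH l k : same_jet1 i x (Hdiag I p q l k) (Hdiag I p q l k).
  by apply: same_jet1_refl; exact: (mCk_at_Hdiag hsmooth).
have JH' l k : same_jet1 i x (Hdiag I q s l k) (Hdiag I q s l k).
  by apply: same_jet1_refl; exact: (mCk_at_Hdiag hsmooth).
have JdH l k e : same_jet1 i x (pderiv i e (Hdiag I p q l k)) (pderiv i e (Hdiag I p q l k)).
  by apply: same_jet1_refl; apply: mCk_at_pderiv => //; exact: (mCk_at_Hdiag hsmooth).
have JG l k d : same_jet1 i x (Gdiag N i p q l k d) (Gdiag N i p q l k d).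
  by apply: same_jet1_refl; exact: (mCk_at_Gdiag hsmooth).
have JG' l k d : same_jet1 i x (Gdiag N i q s l k d) (Gdiag N i q s l k d).
  by apply: same_jet1_refl; exact: (mCk_at_Gdiag hsmooth).
have JdG l k d e :
    same_jet1 i x (pderiv i e (Gdiag N i p q l k d)) (pderiv i e (Gdiag N i p q l k d)).
  by apply: same_jet1_refl; apply: mCk_at_pderiv => //; exact: (mCk_at_Gdiag hsmooth).
have JN (f : M -> R^o) : mCk_at 1 f x -> same_jet1 i x (fun z => - f z) (fun z => - f z).
  by move=> Cf; apply: same_jet1_refl; move=> i' ix'; exact: (Ck_at_opp (Cf i' ix')).
have CV V d : vsmooth V -> mCk_at 1 (vcoord i V d) x by move=> sV; exact: mCk_at_vcoord.
have CdV V d e : vsmooth V -> mCk_at 1 (pderiv i e (vcoord i V d) : M -> R^o) x.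
  by move=> sV; apply: mCk_at_pderiv => //; exact: mCk_at_vcoord.
have Jfo l k d : same_jet1 i x
    (fun z => Hdiag I p q l k z * pderiv i d (t k) z + Gdiag N i p q l k d z * t k z : R^o)
    (fun z => Hdiag I p q l k z * pderiv i d (t' k) z + Gdiag N i p q l k d z * t' k z : R^o).
  by apply: (same_jet1_add ix); apply: (same_jet1_mul ix).
apply: (same_jet1_sum ix) => l; apply: (same_jet1_sum ix) => k.
apply: (same_jet1_sum ix) => e; apply: (same_jet1_sum ix) => d.
apply: (same_jet1_add ix); apply: (same_jet1_mul ix); last exact: Jfo.
- apply: same_jet1_refl; apply: mCk_at_sub; apply: mCk_at_mul; exact: mCk_at_vcoord.
- apply: (same_jet1_add ix); apply: (same_jet1_mul ix); [exact: JH'| |exact: JG'|exact: Jfo].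
  apply: (same_jet1_add ix); last by apply: (same_jet1_mul ix).
  by apply: (same_jet1_add ix); apply: (same_jet1_mul ix).
- apply: (same_jet1_mul ix); first exact: JH'.
  apply: same_jet1_refl; apply: mCk_at_sub; apply: mCk_at_mul.
  + exact: CV.
  + exact: CdV.
  + exact: CV.
  + exact: CdV.
Qed.

End Commutator.
End Curvature.

(** * C^3 sections with a prescribed 2-jet *)

Section SectionEquality.
Variables (R : realType) (n : nat) (M : manifold R n) (r : nat).
Variable E : vbundle M r.

Lemma scomp_inj (p : tidx E) (S T : sec E) x : tdom p x ->
  (forall l, scomp p S l x = scomp p T l x) -> S x = T x.
Proof.
by move=> px H; apply: (can_inj (trivK px)); apply/rowP => l; exact: H.
Qed.

Lemma scomp_combination (p : tidx E) (f : 'I_r -> M -> R) j x : tdom p x ->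
  scomp p (fun z => \sum_(l < r) f l z *: lframe p l z) j x = f j x.
Proof.
move=> px; rewrite /scomp linear_sum summxE (bigD1 j) //= linearZ mxE.
rewrite -/(scomp p (lframe p j) j x) (scomp_frame _ _ px) eqxx mulr1 big1 ?addr0 //.
move=> l lj; rewrite linearZ mxE -/(scomp p (lframe p l) j x) (scomp_frame _ _ px).
by rewrite eq_sym (negPf lj) mulr0.
Qed.

Lemma pderivZ i a (e : R^o) (g : M -> R^o) x : cdom i x -> mCk_at 1 g x ->
  pderiv i a (fun z => e * g z : R^o) x = e * pderiv i a g x.
Proof.
move=> ix Cg; have Ce : mCk_at 1 (fun=> e : R^o) x by exact: mCk_at_cst.
apply: etrans (pderivM a ix Ce Cg) _.
by rewrite (pderiv_cst i a e x) mulr0 addr0.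
Qed.

Lemma pderiv_shift i a (e : R^o) (g : M -> R^o) x : cdom i x -> mCk_at 1 g x ->
  pderiv i a (fun z => e + g z : R^o) x = pderiv i a g x.
Proof.
move=> ix Cg; have Ce : mCk_at 1 (fun=> e : R^o) x by exact: mCk_at_cst.
apply: etrans (pderivD a ix Ce Cg) _.
by rewrite (pderiv_cst i a e x) add0r.
Qed.

(* Second order Taylor polynomial of the components, cut off by a bump function. *)
Lemma taylor_section i (p : tidx E) (T : sec E) x : cdom i x -> tdom p x ->
  Csec 2 T -> exists T' : sec E, [/\ Csec 3 T',
    forall k, same_jet1 i x (scomp p T k) (scomp p T' k) &
    forall k d, same_jet1 i x (pderiv i d (scomp p T k)) (pderiv i d (scomp p T' k))].
Proof.
move=> ix px CT.
have Ct k : mCk_at 2 (scomp p T k) x by exact: mCk_at_scomp.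
pose w (a : 'I_n) z : R^o := - chart i x 0 a + chart i z 0 a.
have Cw m a z : cdom i z -> mCk_at m (w a) z.
  by move=> iz; apply: mCk_at_add; [exact: mCk_at_cst|exact: mCk_at_chart_coord].
have Dw d a z : cdom i z -> pderiv i d (w a) z = (d == a)%:R.
  move=> iz; apply: etrans (pderiv_shift d _ iz (mCk_at_chart_coord 1 a iz)) _.
  exact: pderiv_coord.
have w0 a : w a x = 0 by rewrite /w addNr.
pose t0 k : R^o := scomp p T k x.
pose t1 k a : R^o := pderiv i a (scomp p T k) x.
pose t2 k a b : R^o := pderiv i a (pderiv i b (scomp p T k)) x.
(* The double sum runs over ordered pairs and [t2] is symmetric, so the factor 1/2 makes the
   derivative of the quadratic part along d equal to the sum of [t2 k d a * w a]. *)
pose quad k a b z : R^o := 2^-1 * t2 k a b * (w a z * w b z).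
pose q k z : R^o := t0 k + \sum_(a < n) t1 k a * w a z
  + \sum_(a < n) \sum_(b < n) quad k a b z.
have Cl m k a z : cdom i z -> mCk_at m (fun z => t1 k a * w a z : R^o) z.
  by move=> iz; apply: mCk_at_mul; [exact: mCk_at_cst|exact: Cw].
have Cww m a b z : cdom i z -> mCk_at m (fun z => w a z * w b z : R^o) z.
  by move=> iz; apply: mCk_at_mul; exact: Cw.
have Cquad m k a b z : cdom i z -> mCk_at m (quad k a b) z.
  by move=> iz; apply: mCk_at_mul; [exact: mCk_at_cst|exact: Cww].
have CL m k z : cdom i z -> mCk_at m (fun z => \sum_(a < n) t1 k a * w a z : R^o) z.
  by move=> iz; apply: mCk_at_sum => a _; exact: Cl.
have CQ1 m k a z : cdom i z -> mCk_at m (fun z => \sum_(b < n) quad k a b z : R^o) z.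
  by move=> iz; apply: mCk_at_sum => b _; exact: Cquad.
have CQ m k z : cdom i z ->
    mCk_at m (fun z => \sum_(a < n) \sum_(b < n) quad k a b z : R^o) z.
  by move=> iz; apply: mCk_at_sum => a _; exact: CQ1.
have Cq0 m k z : cdom i z -> mCk_at m (fun z => t0 k + \sum_(a < n) t1 k a * w a z : R^o) z.
  by move=> iz; apply: mCk_at_add; [exact: mCk_at_cst|exact: CL].
have Cq m k z : cdom i z -> mCk_at m (q k) z.
  by move=> iz; apply: mCk_at_add; [exact: Cq0|exact: CQ].
have Dq d k z : cdom i z -> pderiv i d (q k) z =
    t1 k d + \sum_(a < n) t2 k d a * w a z.
  move=> iz; apply: etrans (pderivD d iz (Cq0 1 k z iz) (CQ 1 k z iz)) _.
  apply: (f_equal2 (fun u v : R => u + v)).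
    apply: etrans (pderiv_shift d (t0 k) iz (CL 1 k z iz)) _.
    apply: etrans (pderiv_sum d _ iz (fun a => Cl 1 k a z iz)) _.
    rewrite (bigD1 d) //= big1 ?addr0 => [|a ad].
      apply: etrans (pderivZ d (t1 k d) iz (Cw 1 d z iz)) _.
      by rewrite (Dw d d z iz) eqxx mulr1.
    apply: etrans (pderivZ d (t1 k a) iz (Cw 1 a z iz)) _.
    by rewrite (Dw d a z iz) eq_sym (negPf ad) mulr0.
  apply: etrans (pderiv_sum d _ iz (fun a => CQ1 1 k a z iz)) _.
  transitivity (\sum_(a < n) \sum_(b < n) 2^-1 * t2 k a b *
     (w a z * (d == b)%:R + w b z * (d == a)%:R)).
    apply: eq_bigr => a _.
    apply: etrans (pderiv_sum d _ iz (fun b => Cquad 1 k a b z iz)) _.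
    apply: eq_bigr => b _.
    apply: etrans (pderivZ d (2^-1 * t2 k a b) iz (Cww 1 a b z iz)) _.
    apply: (f_equal2 (fun u v : R => u * v)) => //.
    apply: etrans (pderivM d iz (Cw 1 a z iz) (Cw 1 b z iz)) _.
    by rewrite (Dw d b z iz) (Dw d a z iz).
  have t2C a b : t2 k a b = t2 k b a by exact: pderiv_sym.
  transitivity (\sum_(a < n) 2^-1 * t2 k d a * w a z + \sum_(a < n) 2^-1 * t2 k d a * w a z);
    last first.
    rewrite -big_split; apply: eq_bigr => a _ /=.
    by move: (t2 k d a) (w a z) => y v; field.
  transitivity (\sum_(a < n) (2^-1 * t2 k d a * w a z +
     \sum_(b < n) 2^-1 * t2 k a b * (w b z * (d == a)%:R))).
    apply: eq_bigr => a _; rewrite (t2C d a).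
    under eq_bigr => b _ do rewrite mulrDr.
    rewrite big_split /=; congr (_ + _).
    rewrite (bigD1 d) //= eqxx mulr1 big1 ?addr0 // => b bd.
    by rewrite eq_sym (negPf bd) !mulr0.
  rewrite big_split /=; congr (_ + _).
  rewrite (bigD1 d) //= [X in _ + X]big1 ?addr0 => [|a ad].
    by apply: eq_bigr => b _; rewrite eqxx mulr1.
  by rewrite big1 // => b _; rewrite eq_sym (negPf ad) !mulr0.
have [f [Cf f1 f0]] := bump 3 (nbhs_cdom ix).
have [F [CF Fp]] := frame_extension 3 px.
have Cfq k z : mCk_at 3 (fun z => f z * q k z : R^o) z.
  by apply: (mCk_at_glue Cf f0) => z' iz'; exact: Cq.
pose T' z := \sum_(k < r) (f z * q k z) *: F k z.
have CT' : Csec 3 T'.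
  apply/CsecP => z; apply: Csec_at_sum => k; apply: Csec_at_scale; first exact: Cfq.
  exact: ((CsecP 3 (F k)).1 (CF k) z).
have T'E : \forall z \near x, forall k, q k z = scomp p T' k z.
  move: f1 Fp (nbhs_tdom px); apply: filterS3 => z fz Fz pz k.
  rewrite -[LHS](scomp_combination q k pz) /scomp /T'; congr (triv p z _ 0 k).
  by apply: eq_bigr => l _; rewrite fz mul1r Fz.
have qT' k : \forall z \near x, q k z = scomp p T' k z by apply: filterS T'E.
have refl_near (g : M -> R^o) : \forall z \near x, g z = g z by exact: filterE.
have CT'k m k : (m <= 3)%N -> mCk_at m (scomp p T' k) x.
  by move=> m3; apply: mCk_at_scomp px; exact: Csec_le m3 CT'.
have S1 (g : 'I_n -> R^o) : \sum_(a < n) g a * w a x = 0.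
  by rewrite big1 // => a _; rewrite w0 mulr0.
(* Agreement near [x], and not only at [x], because these derivatives are themselves differentiated
   below. *)
have DqT' k d : \forall z \near x,
    t1 k d + \sum_(a < n) t2 k d a * w a z = pderiv i d (scomp p T' k) z.
  have := nbhs_cdom ix; have := mCk_at_nbhs (CT'k 1 k isT).
  have := near_join (qT' k); apply: filterS3 => z qz Cz iz.
  rewrite -(pderiv_eq d iz (Cq 1 k z iz) qz); exact: esym (Dq d k z iz).
have Cd2 k d a z : cdom i z -> mCk_at 1 (fun z => t2 k d a * w a z : R^o) z.
  by move=> iz; apply: mCk_at_mul; [exact: mCk_at_cst|exact: Cw].
have Cd2s k d : mCk_at 1 (fun z => \sum_(a < n) t2 k d a * w a z : R^o) x.
  by apply: mCk_at_sum => a _; exact: Cd2.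
have qx k : q k x = t0 k.
  rewrite /q (S1 (t1 k)) addr0 big1 ?addr0 // => a _.
  by rewrite big1 // => b _; rewrite /quad w0 mul0r mulr0.
have dqx k d : pderiv i d (scomp p T' k) x = t1 k d.
  by rewrite -(nbhs_singleton (DqT' k d)) (S1 (t2 k d)) addr0.
have Cd1 k d : mCk_at 1 (fun z => t1 k d + \sum_(a < n) t2 k d a * w a z : R^o) x.
  by apply: mCk_at_add; [exact: mCk_at_cst|exact: Cd2s].
exists T'; split; [exact: CT'|move=> k|move=> k d].
  split.
  - exact: mCk_at_le (Ct k).
  - exact: CT'k.
  - by rewrite -(nbhs_singleton (qT' k)) qx.
  - by move=> a; rewrite dqx.
split.
- exact: mCk_at_pderiv (Ct k).
- exact: mCk_at_pderiv (CT'k 2 k isT).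
- by rewrite dqx.
- move=> e; rewrite -(pderiv_eq e ix (Cd1 k d) (DqT' k d)).
  apply: esym; apply: etrans (pderiv_shift e (t1 k d) ix (Cd2s k d)) _.
  apply: etrans (pderiv_sum e _ ix (fun a => Cd2 k d a x ix)) _.
  rewrite (bigD1 e) //= big1 ?addr0 => [|a ae].
    apply: etrans (pderivZ e (t2 k d e) ix (Cw 1 e x ix)) _.
    rewrite (Dw e e x ix) eqxx mulr1.
    exact: pderiv_sym.
  apply: etrans (pderivZ e (t2 k d a) ix (Cw 1 a x ix)) _.
  by rewrite (Dw e a x ix) eq_sym (negPf ae) mulr0.
Qed.

End SectionEquality.

(** * Curvature as a commutator and the cyclic identity *)

Section Bianchi.
Variables (R : realType) (n : nat) (M : manifold R n) (r : nat).
Variables (Lam : Type) (xi : Lam -> vbundle M r).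
Variables (I : transport xi) (N : connection I).
Hypothesis hsmooth : smooth_components N.
Implicit Types (x z : M) (i : cidx M) (V W B C : vfield M).

(** At [x] itself the attached chart and frames are those of the definitions, so R and D unfold
    directly and [curvature_algebra] applies. Class C^1 is all that may be asked of the section,
    since the formula is also used for nab_A T with [T] of class C^2. *)
Lemma curv_sum_comp a b c B C (T : sec (xi a)) j x :
  vsmooth B -> vsmooth C -> Csec 1 T ->
  scomp (triv_at (xi c) x) (curv_sum N b c B C T) j x =
  comm_fun N (chart_at x) (triv_at (xi a) x) (triv_at (xi b) x) (triv_at (xi c) x) B C
    (scomp (triv_at (xi a) x) T) j x.
Proof.
move=> sB sC CT.
set i := chart_at x; have ix : cdom i x := chart_atP x.
set p := triv_at (xi a) x; have px : tdom p x := triv_atP (xi a) x.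
set q := triv_at (xi b) x; have qx : tdom q x := triv_atP (xi b) x.
set s := triv_at (xi c) x; have sx : tdom s x := triv_atP (xi c) x.
have -> : scomp s (curv_sum N b c B C T) j x =
    scomp s (curvR N b c B C T) j x + scomp s (curvD N b c B C T) j x
    + scomp s (trd I c (nabt N b (vbracket B C) T)) j x.
  by rewrite /scomp /curv_sum !linearD !mxE.
rewrite (trd_comp I s _ j qx).
rewrite /comm_fun comm_formE.
rewrite -(curvature_algebra (HG := fun k b a => \sum_(l < r)
    (Hdiag I q s j l x * pderiv i b (Gdiag N i p q l k a) x
     + Gdiag N i q s j l b x * Gdiag N i p q l k a x))
   (D := fun k c b a => Dcomp N i p q s j c k b a x)
   _ _ _ _ (fun k l c => Gdiag N i p p k l c x)) //.
congr (_ + _ + _).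
- rewrite /scomp /curvR -/i -/p -/q -/s.
  exact: (scomp_combination (E := xi c) (p := s) (fun l _ => _) j sx).
- rewrite /scomp /curvD -/i -/p -/q -/s.
  apply: etrans (scomp_combination (E := xi c) (p := s) (fun l _ => _) j sx) _.
  apply: eq_bigr => k _; apply: eq_bigr => d _; apply: eq_bigr => b' _.
  apply: eq_bigr => a' _; congr (_ * _ * _ * _).
  apply: etrans (nab_cfield_comp N d p k ix px CT) _.
  (* The transport of a fibre to itself is the identity, so the connection inside D has the plain
     form: derivative plus Gamma. *)
  rewrite big_split /=; congr (_ + _).
  rewrite (bigD1 k) //= (Hdiag_id I k k px) eqxx mul1r big1 ?addr0 // => l lk.
  by rewrite (Hdiag_id I k l px) eq_sym (negPf lk) mul0r.
- apply: eq_bigr => l _; congr (_ * _).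
  rewrite (nab_comp N q l ix px (vsmooth_vbracket sB sC) CT).
  by apply: eq_bigr => d _; rewrite (vcomp_vbracket sB sC).
Qed.

Lemma curv_sumE a b c B C (T : sec (xi a)) x :
  vsmooth B -> vsmooth C -> Csec 2 T ->
  curv_sum N b c B C T x =
    nabt N c B (nabt N b C T) x - nabt N c C (nabt N b B T) x.
Proof.
move=> sB sC CT; have sx := triv_atP (xi c) x.
apply: (@scomp_inj _ _ _ _ _ _ (curv_sum N b c B C T)
  (fun x => nabt N c B (nabt N b C T) x - nabt N c C (nabt N b B T) x) x sx) => j.
rewrite (curv_sum_comp b c j x sB sC (Csec_le (isT : (1 <= 2)%N) CT)).
rewrite -(commutator_comp hsmooth _ j (chart_atP x) (triv_atP (xi a) x)
  (triv_atP (xi b) x) sB sC CT).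
by rewrite [in RHS]/scomp linearB !mxE.
Qed.

(** The step from attached charts to a fixed one: at every z near [x], [curv_sumE] gives the
    chart-free commutator, which is then expanded in the given chart and frames. *)
Lemma curv_sum_near a b c i (p : tidx (xi a)) (q : tidx (xi b)) (s : tidx (xi c))
    B C (T : sec (xi a)) j x :
  cdom i x -> tdom p x -> tdom q x -> tdom s x -> vsmooth B -> vsmooth C ->
  Csec 2 T -> \forall z \near x,
    comm_fun N i p q s B C (scomp p T) j z = scomp s (curv_sum N b c B C T) j z.
Proof.
move=> ix px qx sx sB sC CT; move: (nbhs_cdom ix) (nbhs_tdom px) (nbhs_tdom qx).
apply: filterS3 => z iz pz qz.
rewrite -(commutator_comp hsmooth s j iz pz qz sB sC CT).
by rewrite [in RHS]/scomp (curv_sumE _ _ _ sB sC CT) linearB !mxE.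
Qed.

Lemma same_jet1_curv_sum a b c i (p : tidx (xi a)) (q : tidx (xi b)) (s : tidx (xi c))
    B C (T T' : sec (xi a)) j x :
  cdom i x -> tdom p x -> tdom q x -> tdom s x -> vsmooth B -> vsmooth C ->
  Csec 2 T -> Csec 2 T' ->
  (forall k, same_jet1 i x (scomp p T k) (scomp p T' k)) ->
  (forall k d, same_jet1 i x (pderiv i d (scomp p T k)) (pderiv i d (scomp p T' k))) ->
  same_jet1 i x (scomp s (curv_sum N b c B C T) j) (scomp s (curv_sum N b c B C T') j).
Proof.
move=> ix px qx sx sB sC CT CT' J J'.
apply: (same_jet1_near ix (curv_sum_near j ix px qx sx sB sC CT)
  (curv_sum_near j ix px qx sx sB sC CT')).
exact: same_jet1_comm_fun.
Qed.

(** Since [same_jet1] contains C^1 regularity, comparing [T] with itself yields the claim. *)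
Lemma Csec_curv_sum a b c B C (T : sec (xi a)) :
  vsmooth B -> vsmooth C -> Csec 2 T -> Csec 1 (curv_sum N b c B C T).
Proof.
move=> sB sC CT; apply/CsecP => x.
have ix := chart_atP x; have px := triv_atP (xi a) x.
have qx := triv_atP (xi b) x; have sx := triv_atP (xi c) x.
apply: (Csec_at_of_frame sx) => j.
have Ct k : mCk_at 2 (scomp (triv_at (xi a) x) T k) x by exact: mCk_at_scomp.
have J k : same_jet1 (chart_at x) x (scomp (triv_at (xi a) x) T k)
    (scomp (triv_at (xi a) x) T k).
  by apply: same_jet1_refl; exact: mCk_at_le (Ct k).
have J' k d : same_jet1 (chart_at x) x (pderiv (chart_at x) d (scomp (triv_at (xi a) x) T k))
    (pderiv (chart_at x) d (scomp (triv_at (xi a) x) T k)).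
  by apply: same_jet1_refl; apply: mCk_at_pderiv.
by have [] := same_jet1_curv_sum j ix px qx sx sB sC CT CT J J'.
Qed.

Lemma nabt_jet a b i (p : tidx (xi a)) V (S S' : sec (xi a)) x :
  cdom i x -> tdom p x -> vsmooth V -> Csec 1 S -> Csec 1 S' ->
  (forall k, same_jet1 i x (scomp p S k) (scomp p S' k)) ->
  nabt N b V S x = nabt N b V S' x.
Proof.
move=> ix px sV CS CS' J; apply: (scomp_inj (triv_atP (xi b) x)) => l.
rewrite (nab_comp N _ l ix px sV CS) (nab_comp N _ l ix px sV CS').
apply: eq_bigr => d _; congr (_ * _); apply: eq_bigr => k _.
by have [_ _ -> ->] := J k.
Qed.

(** Only the value at [x] is compared, so the formula for C^1 sections in the attached chart is
    enough; this is what permits S = nab_A T. *)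
Lemma curv_sum_jet a b c (S S' : sec (xi a)) B C x :
  vsmooth B -> vsmooth C -> Csec 1 S -> Csec 1 S' ->
  (forall k, same_jet1 (chart_at x) x (scomp (triv_at (xi a) x) S k)
                  (scomp (triv_at (xi a) x) S' k)) ->
  curv_sum N b c B C S x = curv_sum N b c B C S' x.
Proof.
move=> sB sC CS CS' J; apply: (scomp_inj (triv_atP (xi c) x)) => j.
rewrite (curv_sum_comp b c j x sB sC CS) (curv_sum_comp b c j x sB sC CS').
rewrite /comm_fun; congr comm_form.
  by apply/funext => k; have [] := J k.
by apply/funext => k; apply/funext => d; have [_ _ _] := J k.
Qed.

Lemma same_jet1_nabt a b i (p : tidx (xi a)) (q : tidx (xi b)) V (T T' : sec (xi a)) l x :
  cdom i x -> tdom p x -> tdom q x -> vsmooth V -> Csec 2 T -> Csec 2 T' ->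
  (forall k, same_jet1 i x (scomp p T k) (scomp p T' k)) ->
  (forall k d, same_jet1 i x (pderiv i d (scomp p T k)) (pderiv i d (scomp p T' k))) ->
  same_jet1 i x (scomp q (nabt N b V T) l) (scomp q (nabt N b V T') l).
Proof.
move=> ix px qx sV CT CT' J J'.
have C1 : Csec 1 T by exact: Csec_le CT.
have C1' : Csec 1 T' by exact: Csec_le CT'.
apply: (same_jet1_near ix (nabt_near N q l ix px sV C1) (nabt_near N q l ix px sV C1')).
apply: (same_jet1_sum ix) => d; apply: (same_jet1_mul ix).
  by apply: same_jet1_refl; exact: mCk_at_vcoord.
apply: (same_jet1_sum ix) => k; apply: (same_jet1_add ix); apply: (same_jet1_mul ix).
- by apply: same_jet1_refl; exact: (mCk_at_Hdiag hsmooth).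
- exact: J'.
- by apply: same_jet1_refl; exact: (mCk_at_Gdiag hsmooth).
- exact: J.
Qed.

(** The outer nab_A sees the 1-jet of the curvature sum of [T]; the other summand sees the 1-jet of
    nab_A T. Both are determined by the 2-jet of [T]. *)
Lemma bianchi_term_jet a b c d A B C (T T' : sec (xi a)) x :
  let i := chart_at x in let p := triv_at (xi a) x in
  vsmooth A -> vsmooth B -> vsmooth C -> Csec 2 T -> Csec 2 T' ->
  (forall k, same_jet1 i x (scomp p T k) (scomp p T' k)) ->
  (forall k d, same_jet1 i x (pderiv i d (scomp p T k)) (pderiv i d (scomp p T' k))) ->
  bianchi_term N b c d A B C T x = bianchi_term N b c d A B C T' x.
Proof.
move=> i p sA sB sC CT CT' J J'.
have ix : cdom i x := chart_atP x; have px : tdom p x := triv_atP (xi a) x.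
have qx := triv_atP (xi b) x; have sx := triv_atP (xi c) x.
rewrite /bianchi_term; congr (_ - _).
  apply: (nabt_jet _ ix sx sA).
  - exact: Csec_curv_sum.
  - exact: Csec_curv_sum.
  - move=> k; exact: (same_jet1_curv_sum k ix px qx sx sB sC CT CT' J J').
apply: (curv_sum_jet c d sB sC).
- exact: (Csec_nabt hsmooth).
- exact: (Csec_nabt hsmooth).
by move=> k; exact: (same_jet1_nabt k ix px qx sA CT CT' J J').
Qed.

Lemma nabtB a b V (S T : sec (xi a)) x : Csec 1 S -> Csec 1 T ->
  nabt N b V (fun z => S z - T z) x = nabt N b V S x - nabt N b V T x.
Proof.
move=> CS CT.
have CST : Csec 1 (fun z => S z - T z).
  apply/CsecP => z.
  have Cm : mCk_at 1 (fun=> -1 : R^o) z by exact: mCk_at_cst.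
  have CN := Csec_at_scale Cm ((CsecP 1 T).1 CT z).
  have := Csec_at_add ((CsecP 1 S).1 CS z) CN.
  by apply: Csec_at_eq; apply: filterE => w; rewrite scaleN1r.
apply/eqP; rewrite eq_sym subr_eq; apply/eqP.
rewrite /nabt -(nabD N b x V CST CT); congr (nab N b x V _ x).
by apply: functional_extensionality_dep => z; rewrite subrK.
Qed.

(** Class C^3 makes nab_A T of class C^2, so [curv_sumE] applies to it as well. For [T] the equality
    holds at every point, hence it may be used under the outer derivative. *)
Lemma bianchi_termE a b c d A B C (T : sec (xi a)) x :
  vsmooth A -> vsmooth B -> vsmooth C -> Csec 3 T ->
  bianchi_term N b c d A B C T x =
    (nabt N d A (nabt N c B (nabt N b C T)) x
      - nabt N d A (nabt N c C (nabt N b B T)) x)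
    - (nabt N d B (nabt N c C (nabt N b A T)) x
      - nabt N d C (nabt N c B (nabt N b A T)) x).
Proof.
move=> sA sB sC CT.
have C2 V : vsmooth V -> Csec 2 (nabt N b V T).
  by move=> sV; exact: (Csec_nabt hsmooth).
have C1 V W : vsmooth V -> vsmooth W -> Csec 1 (nabt N c V (nabt N b W T)).
  by move=> sV sW; apply: (Csec_nabt hsmooth) => //; exact: C2.
rewrite /bianchi_term; congr (_ - _); last by rewrite (curv_sumE _ _ _ sB sC (C2 _ sA)).
rewrite -(nabtB d A x (C1 B C sB sC) (C1 C B sC sB)).
rewrite /nabt; congr (nab N d x A _ x).
apply: functional_extensionality_dep => z.
by rewrite (curv_sumE _ _ _ sB sC (Csec_le (isT : (2 <= 3)%N) CT)).
Qed.

End Bianchi.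

(** The six elements stand for the triple covariant derivatives. Since the bundle indices are not
    permuted, each of these depends only on the order of A, B, C, and each occurs twice with
    opposite signs. *)
Lemma cyclic_commutator_sum (G : zmodType) (abc acb bca cba bac cab : G) :
  abc - acb - (bca - cba) + (bca - bac - (cab - acb))
  + (cab - cba - (abc - bac)) = 0.
Proof.
rewrite !opprB !addrA !subrK (addrAC abc (- acb) cba).
rewrite (addrAC _ (- bac) acb) subrK (addrAC _ (- bac) (- cba)) addrK.
by rewrite subrK subrr.
Qed.

Theorem mainTheorem5 (R : realType) (n r : nat) (M : manifold R n)
    (Lam : Type) (xi : Lam -> vbundle M r)
    (I : transport xi) (N : connection I) (hsmooth : smooth_components N)
    (a b c d : Lam) (A B C : vfield M)
    (hA : vsmooth A) (hB : vsmooth B) (hC : vsmooth C)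
    (T : sec (xi a)) (hT : Csec 2 T) (x : M) :
  bianchi_term N b c d A B C T x
  + bianchi_term N b c d B C A T x
  + bianchi_term N b c d C A B T x = 0.
Proof.
have ix := chart_atP x; have px := triv_atP (xi a) x.
have [T' [CT' J J']] := taylor_section ix px hT.
have C2 := Csec_le (isT : (2 <= 3)%N) CT'.
rewrite (bianchi_term_jet hsmooth b c d hA hB hC hT C2 J J').
rewrite (bianchi_term_jet hsmooth b c d hB hC hA hT C2 J J').
rewrite (bianchi_term_jet hsmooth b c d hC hA hB hT C2 J J').
rewrite (bianchi_termE hsmooth b c d x hA hB hC CT').
rewrite (bianchi_termE hsmooth b c d x hB hC hA CT').
rewrite (bianchi_termE hsmooth b c d x hC hA hB CT').
exact: cyclic_commutator_sum.
Qed.
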